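(* Let $r$ be a positive integer and let $(a_0,\dots,a_b)$ be a path in $T(n)$ of length $b$ with $0\le b\le r$. Assume that $a_0$ is a sink of $\Omega$ if $r$ is even, and a source of $\Omega$ if $r$ is odd. Then there is a regular indecomposable representation $M$ of $(T(n),\Omega)$ which is the sink module of smallest radius in its shift orbit (i.e. $M=M_0$) and satisfies $r_0(M)=r$ and $\pi(M)=(a_0,\dots,a_b)$.
   Context: Let $k$ be a field and $n\ge 3$ an integer. $T(n)$ denotes the $n$-regular tree (every vertex has exactly $n$ neighbours). A path of length $t\ge 0$ is a sequence $(a_0,\dots,a_t)$ of vertices with $a_{i-1},a_i$ neighbours and $a_{i-1}\neq a_{i+1}$; $d(a,a')$ is the length of the unique path from $a$ to $a'$. A path of length $2r$ has center $a_r$ and radius $r$; a path of length $2r+1$ has center the edge $\{a_r,a_{r+1}\}$ and radius $r$. Fix a bipartite orientation $\Omega$ of $T(n)$ (every vertex is a sink or a source) and let $\sigma\Omega$ be the opposite orientation. A module is a finite-dimensional $k$-representation of $(T(n),\Omega)$ or $(T(n),\sigma\Omega)$. The shift functor $\sigma$ is the composition of the Bernstein–Gelfand–Ponomarev reflection functors at all sinks (mapping representations of $(T(n),\Omega)$ to those of $(T(n),\sigma\Omega)$ and vice versa); $\sigma^-$ is its left adjoint and $\sigma^t=(\sigma^-)^{-t}$ for $t<0$. An indecomposable module $M$ is regular if $\sigma^tM\neq0$ for all $t\in\mathbb Z$; its shift orbit is $\{\sigma^tM:t\in\mathbb Z\}$. The support $T(M)$ of an indecomposable $M$ is the full subgraph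 on vertices $a$ with $M_a\ne 0$; a diameter path is a path in $T(M)$ of maximal length $d(M)$; all diameter paths have a common center (the center of $M$), and $r(M)=\lfloor d(M)/2\rfloor$. $M$ is a sink (resp. source) module if its diameter paths start and end in sinks (resp. sources) of the orientation of its quiver, and a flow module if $d(M)$ is odd. Fact (structure of shift orbits): for regular indecomposable $M$, the shift orbit contains a unique sink module $M_0$ of smallest radius; put $r_0(M)=r(M_0)$ and $M_i=\sigma^iM_0$; there is $b\ge 0$ such that $M_1,\dots,M_b$ are exactly the flow modules in the orbit and $M_{b+1}$ is a source module, the modules $M_i$, $i\le 0$, are sink modules with center $a_0$, $M_i$ ($1\le i\le b$) has center an edge $\{a_{i-1},a_i\}$, and the modules $M_{i}$, $i\ge b+1$, are source modules with center $a_b$, where $(a_0,\dots,a_b)$ is a path. This path is the center path $\pi(M)$. *)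

(* Defs.v *)
From HB Require Import structures.
From mathcomp Require Import all_boot all_order all_algebra.
Set Implicit Arguments. Unset Strict Implicit. Unset Printing Implicit Defensive.
Import GRing.Theory.
Local Open Scope ring_scope.

(* The n-regular tree T(n): vertices are reduced words over 'I_n (no two    *)
(* consecutive equal letters; the head of the list is the last letter).     *)
(* The i-th neighbour of w is w.i (cancelling if w ends with i).  This is    *)
(* the Cayley graph of the free product of n copies of Z/2, i.e. T(n).      *)

Definition reduced (n : nat) (w : seq 'I_n) : bool :=
  sorted (fun x y : 'I_n => x != y) w.

Definition Vtx (n : nat) := {w : seq 'I_n | reduced w}.

Definition root_vtx (n : nat) : Vtx n := exist _ [::] isT.

Definition nbw (n : nat) (w : seq 'I_n) (i : 'I_n) : seq 'I_n :=
  if w is j :: w' then (if j == i then w' else i :: w) else [:: i].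

Lemma nbw_reduced (n : nat) (w : seq 'I_n) (i : 'I_n) :
  reduced w -> reduced (nbw w i).
Proof.
case: w => [|j w] //= H.
case: (eqVneq j i) => [_|ne].
  by case: w H => //= x s /andP[].
by rewrite /reduced /= eq_sym ne.
Qed.

Definition nb (n : nat) (v : Vtx n) (i : 'I_n) : Vtx n :=
  exist _ (nbw (proj1_sig v) i) (nbw_reduced i (proj2_sig v)).

Definition adj (n : nat) (a b : Vtx n) : bool := [exists i : 'I_n, nb a i == b].

(* Bipartite orientations: an orientation is encoded by a boolean o; the
   sinks of orientation o are the vertices v with odd |v| == o, all other
   vertices are sources.  The opposite orientation of o is ~~ o. *)
Definition is_sink (n : nat) (o : bool) (v : Vtx n) : bool :=
  odd (size (proj1_sig v)) == o.

Definition arrow (n : nat) (o : bool) (a b : Vtx n) : bool :=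
  adj a b && is_sink o b.

(* Representations.  A representation of (T(n), o) assigns k^(dm v) to each *)
(* vertex v and, for each arrow a -> b, the linear map x |-> x *m mp a b     *)
(* (row-vector convention).  Entries mp a b for non-arrows are irrelevant.  *)
(* Finite-dimensionality is the predicate fin_supp.                         *)

Record rep (k : fieldType) (n : nat) := Rep {
  ori : bool;
  dm : Vtx n -> nat;
  mp : forall a b : Vtx n, 'M[k]_(dm a, dm b)
}.

Definition fin_supp (k : fieldType) (n : nat) (M : rep k n) : Prop :=
  exists s : seq (Vtx n), forall v, (0 < dm M v)%N -> v \in s.

Definition nonzero_rep (k : fieldType) (n : nat) (M : rep k n) : Prop :=
  exists v, (0 < dm M v)%N.

Definition indecomposable (k : fieldType) (n : nat) (M : rep k n) : Prop :=
  nonzero_rep M /\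
  ~ exists (U W : forall v : Vtx n, 'M[k]_(dm M v)),
      (forall v, (1%:M <= U v + W v)%MS && ((U v :&: W v)%MS == 0)) /\
      (forall a b, arrow (ori M) a b ->
          (U a *m mp M a b <= U b)%MS /\ (W a *m mp M a b <= W b)%MS) /\
      (exists v, U v != 0) /\ (exists v, W v != 0).

(* ---- the shift functor sigma: BGP reflection at all sinks ---- *)

Definition sink_map (k : fieldType) (n : nat) (M : rep k n) (a : Vtx n) :
  'M[k]_(\sum_(i < n) dm M (nb a i), dm M a) :=
  \mxcol_(i < n) mp M (nb a i) a.

Definition sink_ker (k : fieldType) (n : nat) (M : rep k n) (a : Vtx n) :=
  row_base (kermx (sink_map M a)).

Definition sigma_dm (k : fieldType) (n : nat) (M : rep k n) (v : Vtx n) : nat :=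
  if is_sink (ori M) v then \rank (kermx (sink_map M v)) else dm M v.

(* new map from the old sink a to the old source b = nb a i:
   kernel inclusion followed by projection onto the i-th summand *)
Definition sigma_mp (k : fieldType) (n : nat) (M : rep k n) (a b : Vtx n) :
  'M[k]_(sigma_dm M a, sigma_dm M b) :=
  conform_mx 0
   (\sum_(i < n | nb a i == b)
       conform_mx (0 : 'M[k]_(\rank (kermx (sink_map M a)), dm M b))
                  (submxrow (sink_ker M a) i)).

Definition sigma (k : fieldType) (n : nat) (M : rep k n) : rep k n :=
  @Rep k n (~~ ori M) (sigma_dm M) (sigma_mp M).

(* ---- sigma^- : BGP reflection at all sources (cokernels) ---- *)

Definition source_map (k : fieldType) (n : nat) (M : rep k n) (a : Vtx n) :
  'M[k]_(dm M a, \sum_(i < n) dm M (nb a i)) :=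
  \mxrow_(i < n) mp M a (nb a i).

(* x |-> x *m source_coker a is a surjection of (+)_i V_{nb a i} onto
   k^(rank) whose kernel is exactly the image of source_map, i.e. it is
   the cokernel projection *)
Definition source_coker (k : fieldType) (n : nat) (M : rep k n) (a : Vtx n) :=
  col_base (cokermx (source_map M a)).

Definition sigmam_dm (k : fieldType) (n : nat) (M : rep k n) (v : Vtx n) : nat :=
  if ~~ is_sink (ori M) v then \rank (cokermx (source_map M v)) else dm M v.

Definition sigmam_mp (k : fieldType) (n : nat) (M : rep k n) (b a : Vtx n) :
  'M[k]_(sigmam_dm M b, sigmam_dm M a) :=
  conform_mx 0
   (\sum_(i < n | nb a i == b)
       conform_mx (0 : 'M[k]_(dm M b, \rank (cokermx (source_map M a))))
                  (submxcol (source_coker M a) i)).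

Definition sigmam (k : fieldType) (n : nat) (M : rep k n) : rep k n :=
  @Rep k n (~~ ori M) (sigmam_dm M) (sigmam_mp M).

Definition shift (k : fieldType) (n : nat) (t : int) (M : rep k n) : rep k n :=
  match t with
  | Posz m => iter m (@sigma k n) M
  | Negz m => iter m.+1 (@sigmam k n) M
  end.

Definition regular (k : fieldType) (n : nat) (M : rep k n) : Prop :=
  forall t : int, nonzero_rep (shift t M).

Definition is_tpath (n : nat) (x : Vtx n) (s : seq (Vtx n)) : bool :=
  path (@adj n) x s &&
  all (fun i => nth x (x :: s) i != nth x (x :: s) i.+2) (iota 0 (size s).-1).

Definition supp_path (k : fieldType) (n : nat) (M : rep k n)
  (x : Vtx n) (s : seq (Vtx n)) : Prop :=
  is_tpath x s /\ all (fun v => 0 < dm M v)%N (x :: s).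

Definition diam (k : fieldType) (n : nat) (M : rep k n) (d : nat) : Prop :=
  (exists x s, supp_path M x s /\ size s = d) /\
  (forall x s, supp_path M x s -> (size s <= d)%N).

Definition diam_path (k : fieldType) (n : nat) (M : rep k n)
  (x : Vtx n) (s : seq (Vtx n)) : Prop :=
  supp_path M x s /\ diam M (size s).

Definition sink_module (k : fieldType) (n : nat) (M : rep k n) : Prop :=
  forall x s, diam_path M x s ->
    is_sink (ori M) x /\ is_sink (ori M) (last x s).

Definition source_module (k : fieldType) (n : nat) (M : rep k n) : Prop :=
  forall x s, diam_path M x s ->
    ~~ is_sink (ori M) x /\ ~~ is_sink (ori M) (last x s).

Definition flow_module (k : fieldType) (n : nat) (M : rep k n) : Prop :=
  exists d, diam M d /\ odd d.

Definition radius (k : fieldType) (n : nat) (M : rep k n) (rr : nat) : Prop :=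
  exists d, diam M d /\ d./2 = rr.

Definition center_vertex (k : fieldType) (n : nat) (M : rep k n) (c : Vtx n) : Prop :=
  exists d, diam M d /\ ~~ odd d /\
    forall x s, diam_path M x s -> nth x (x :: s) d./2 = c.

Definition center_edge (k : fieldType) (n : nat) (M : rep k n) (a a' : Vtx n) : Prop :=
  exists d, diam M d /\ odd d /\
    forall x s, diam_path M x s ->
      let u := nth x (x :: s) d./2 in let w := nth x (x :: s) d./2.+1 in
      ((u == a) && (w == a')) || ((u == a') && (w == a)).

Definition is_M0 (k : fieldType) (n : nat) (M : rep k n) : Prop :=
  sink_module M /\
  forall (t : int) (r1 r2 : nat), sink_module (shift t M) ->
    radius M r1 -> radius (shift t M) r2 -> (r1 <= r2)%N.

Definition center_path (k : fieldType) (n : nat) (M : rep k n)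
  (x : Vtx n) (s : seq (Vtx n)) : Prop :=
  center_vertex M x /\
  (forall i : nat, (1 <= i <= size s)%N ->
     flow_module (shift i%:Z M) /\
     center_edge (shift i%:Z M) (nth x (x :: s) i.-1) (nth x (x :: s) i)) /\
  source_module (shift (size s).+1%:Z M).

(* Main.v *)
Require Import Defs.
From HB Require Import structures.
From mathcomp Require Import all_boot all_order all_algebra.
From mathcomp Require Import zify ring.
From Stdlib Require Import Classical_Prop IndefiniteDescription.
Set Implicit Arguments. Unset Strict Implicit. Unset Printing Implicit Defensive.
Import GRing.Theory Num.Theory.

(* Write x = a_0, y = a_b, rho = r - b.  For b > 0 start with the thin        *)
(* representation of the ball of radius rho around x, apply sigma^- b times   *)
(* and delete the boundary vertices of the resulting ball of radius r that    *)
(* lie beyond y.  Under sigma the support shrinks by one at each step, except *)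
(* that each deleted vertex reappears and becomes the center of a growing     *)
(* ball.  So after i <= b steps one sees a ball of radius r - i around x and  *)
(* balls of radius i - 1 around the deleted vertices, whose union has the     *)
(* center edge {a_(i-1), a_i}; after b + 1 steps it is a source module with   *)
(* center y.  The supports of sigma^t M are bounded above by locality of      *)
(* sigma (M agrees with the undeleted module away from the deleted vertices)  *)
(* and below by following the injective maps (sigma^-) or surjective maps     *)
(* (sigma) along geodesics.  For b = 0 one takes k^2 on the ball of radius    *)
(* r - 1, with a functional on k^2 at each boundary vertex; the functionals   *)
(* have three different kernels, so that no boundary vertex dies under sigma. *)

(** * The tree and its geodesics *)

(** The statement reduces to supports. In a tree, a non-backtracking path inside a ball of radius R
    has length at most 2R, and at length 2R its midpoint is the center of the ball; likewise for
    neighbourhoods of an edge ([tpath_ball], [tpath_edge]). Hence it suffices to know, for every t,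
    a ball or edge neighbourhood containing the support of sigma^t M, together with one path in that
    support of the greatest possible length. Radius, center and the sink, source or flow type then
    follow by parity; this is [shift_orbit_criterion].

    Upper bounds: a reflected vertex is nonzero only if a neighbour was ([sigma_supp]), and sigma M
    near v depends only on M near v ([iso_on_sigma]). Lower bounds: if one map into a sink a is
    surjective, then after the reflection the map from a to every other neighbour is surjective
    ([sigma_row_full], with the joint version [jsurj_sigma]). Surjectivity thus moves along
    geodesics and carries the support outwards ([line_grow_sigma]). Injectivity does the same under
    sigma^- ([jinj_sigmam], [line_grow_sigmam]).

    Indecomposability is checked by hand for representations that are constant inside a ball
    ([ball_rep_indecomposable]). Elsewhere it is transported: a decomposition of M induces one of
    sigma M, even after sigma M has been truncated to zero at some sinks ([indecomposable_kernel]).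
    This covers sigma^- ([indecomposable_sigmam]) and the deletion of boundary vertices
    ([del_rep_indecomposable]). The two constructions are completed in [star_case] (b = 0) and
    [flow_case] (b > 0). *)

Section Tree.
Variable n : nat.
Implicit Types (u v c : Vtx n) (i : 'I_n).

Definition act (w s : seq 'I_n) : seq 'I_n := foldr (fun i w' => nbw w' i) w s.

(** The letters are involutions, so [rev] inverts a word, and [act] multiplies on the right with
    cancellation. The value is therefore the word length of c^-1 v, the distance in the Cayley
    graph. *)
Definition dist c v : nat := size (act (rev (val c)) (val v)).

Lemma nbwK (w : seq 'I_n) i : reduced w -> nbw (nbw w i) i = w.
Proof.
case: w => [|j w] /=; first by rewrite eqxx.
case: (eqVneq j i) => [->|ne] /=; last by rewrite eqxx.
by case: w => [|l w] //= /andP[]; rewrite eq_sym => /negPf ->.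
Qed.

Lemma reduced_act (w s : seq 'I_n) : reduced w -> reduced (act w s).
Proof. by move=> rw; elim: s => //= i s; apply: nbw_reduced. Qed.

Lemma reduced_rev (w : seq 'I_n) : reduced w -> reduced (rev w).
Proof.
rewrite /reduced rev_sorted => h.
by rewrite (eq_sorted (e' := fun a b : 'I_n => a != b)) // => a b; rewrite eq_sym.
Qed.

Lemma nbK v i : nb (nb v i) i = v.
Proof. by apply: val_inj; rewrite /= nbwK //; case: v. Qed.

Lemma nb_inj v : injective (nb v).
Proof.
move=> i j /(congr1 val) /=.
case: v => [[|l w] rw] /=; first by case.
have [<-|ni] := eqVneq l i; have [ej|nj] := eqVneq l j => //.
- by move=> e; have := congr1 size e; rewrite /=; lia.
- by move=> e; have := congr1 size e; rewrite /=; lia.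
by case.
Qed.

Lemma act_nb c v i :
  act (rev (val c)) (val (nb v i)) = nbw (act (rev (val c)) (val v)) i.
Proof.
have rc : reduced (rev (val c)) by apply/reduced_rev/(valP c).
case: v => [[|j w] rw] //=.
by case: (eqVneq j i) => [->|] //=; rewrite nbwK //; apply: reduced_act.
Qed.

Lemma dist_self c : dist c c = 0.
Proof.
rewrite /dist; case: c => w _ /=.
elim/last_ind: w => //= w i ih.
by rewrite rev_rcons /act -cats1 foldr_cat /= eqxx.
Qed.

Lemma act_catr (w s t : seq 'I_n) : act w (s ++ t) = act (act w t) s.
Proof. by rewrite /act foldr_cat. Qed.

Lemma act_rev (w s : seq 'I_n) : reduced w -> act (act w s) (rev s) = w.
Proof.
elim: s w => [|i s ih] w rw //=.
rewrite rev_cons -cats1 act_catr /= nbwK ?ih //; exact: reduced_act.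
Qed.

Lemma act_nil (s : seq 'I_n) : reduced s -> act [::] s = s.
Proof.
elim: s => //= i s ih rs.
have {}ih : act [::] s = s by apply: ih; move: rs; rewrite /reduced /=; apply: path_sorted.
rewrite ih; case: s rs {ih} => //= j s /andP[]; by rewrite eq_sym => /negPf ->.
Qed.

Lemma dist_eq0 c v : (dist c v == 0) = (v == c).
Proof.
apply/idP/eqP => [|->]; last by rewrite dist_self.
rewrite size_eq0 => /eqP e.
have rc : reduced (rev (val c)) by apply/reduced_rev/(valP c).
have := act_rev (val v) rc; rewrite e act_nil; last exact/reduced_rev/(valP v).
by move=> /(can_inj revK) /val_inj.
Qed.

Lemma dist_nb c v i :
  dist c (nb v i) = if ohead (act (rev (val c)) (val v)) == Some i
                    then (dist c v).-1 else (dist c v).+1.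
Proof.
rewrite /dist act_nb; case: (act _ _) => [|j w] //=.
by rewrite (inj_eq Some_inj); case: eqP.
Qed.

Lemma dist_down_nb c v : 0 < dist c v -> exists i, (dist c (nb v i)).+1 = dist c v.
Proof.
move=> h; have := dist_nb c v; move: h; rewrite /dist.
case: (act _ _) => [|j w] //= _ /(_ j); rewrite eqxx => h.
by exists j; rewrite h.
Qed.

Lemma adjP u v : reflect (exists i, v = nb u i) (adj u v).
Proof. by apply: (iffP existsP) => -[i]; [move/eqP<- | move->]; exists i. Qed.

Lemma adj_nb v i : adj v (nb v i).
Proof. by apply/adjP; exists i. Qed.

Lemma adj_sym u v : adj u v = adj v u.
Proof.
by apply/adjP/adjP => -[i ->]; exists i; rewrite nbK.
Qed.

Lemma dist_adj c u v : adj u v -> dist c v = (dist c u).+1 \/ dist c u = (dist c v).+1.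
Proof.
move=> /adjP[i ->]; rewrite dist_nb /dist.
by case: (act _ _) => [|j w] /=; [left | case: ifP => _; [right|left]].
Qed.

(** Only the last letter of the reduced word of c^-1 v can cancel. This is the form in which
    acyclicity of the tree is used. *)
Lemma dist_down_uniq c v u u' : adj v u -> adj v u' ->
  dist c v = (dist c u).+1 -> dist c v = (dist c u').+1 -> u = u'.
Proof.
move=> /adjP[i ->] /adjP[j ->]; rewrite !dist_nb.
case: eqP => [e1 | _]; case: eqP => [e2|_] //; try lia.
by move: e1; rewrite e2 => -[->].
Qed.

Lemma dist_walk c s : path (@adj n) c s -> dist c (last c s) <= size s.
Proof.
elim/last_ind: s => [|s v ih] /=; first by rewrite dist_self.
rewrite rcons_path last_rcons size_rcons => /andP[/ih h /dist_adj h'].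
by move: (h' c); lia.
Qed.

Lemma walk_dist c v : exists s, [/\ path (@adj n) c s, last c s = v & size s = dist c v].
Proof.
move em: (dist c v) => m; elim: m v em => [|m ih] v e.
  by exists [::]; split=> //; move/eqP: e; rewrite dist_eq0 => /eqP.
have [i ei] : exists i, (dist c (nb v i)).+1 = dist c v.
  by apply: dist_down_nb; rewrite e.
have [|s [ps ls ss]] := ih (nb v i); first by lia.
exists (rcons s v); rewrite rcons_path ps ls last_rcons size_rcons ss; split=> //.
by rewrite adj_sym adj_nb.
Qed.

Lemma dist_triangle u v (w : Vtx n) : dist u w <= dist u v + dist v w.
Proof.
have [s [ps ls <-]] := walk_dist u v; have [t [pt lt <-]] := walk_dist v w.
have := @dist_walk u (s ++ t).
by rewrite cat_path ps ls pt last_cat ls lt size_cat; apply.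
Qed.

Lemma dist_sym u v : dist u v = dist v u.
Proof.
suff h a b : dist b a <= dist a b by apply/eqP; rewrite eqn_leq !h.
have [s [ps ls <-]] := walk_dist a b.
have := @dist_walk b (rev (belast a s)).
rewrite size_rev size_belast -{1}ls rev_path.
rewrite (eq_path (e' := @adj n)) => [/(_ ps)|? ?]; last by rewrite adj_sym.
case: s ps ls => [|x s] /=; first by move=> _ -> .
by move=> _ _; rewrite rev_cons last_rcons.
Qed.

Lemma dist_adj_l c c' v : adj c c' -> dist c' v = (dist c v).+1 \/ dist c v = (dist c' v).+1.
Proof. by rewrite ![dist _ v]dist_sym; apply: dist_adj. Qed.

Definition vodd v : bool := odd (size (val v)).

Lemma vodd_adj u v : adj u v -> vodd v = ~~ vodd u.
Proof.
move=> /adjP[i ->]; rewrite /vodd /=; case: (val u) => [|j w] //=.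
by case: eqP => //=; rewrite negbK.
Qed.

Lemma vodd_dist c v : vodd v = vodd c (+) odd (dist c v).
Proof.
have [s [ps ls <-]] := walk_dist c v; rewrite -{}ls.
elim: s c ps => [|u s ih] c /=; first by rewrite addbF.
move=> /andP[/vodd_adj e /ih ->]; rewrite e; by case: (vodd c); case: (odd _).
Qed.

Lemma is_sinkE o v : is_sink o v = ~~ (vodd v (+) o).
Proof. by rewrite /is_sink /vodd; case: (odd _); case: o. Qed.

Definition ball_seq c (R : nat) : seq (Vtx n) :=
  iter R (fun s => s ++ flatten (map (fun v => map (@nb n v) (enum 'I_n)) s)) [:: c].

Lemma mem_ball c R v : dist c v <= R -> v \in ball_seq c R.
Proof.
elim: R v => [|R ih] v.
  by rewrite leqn0 dist_eq0 => /eqP ->; rewrite inE.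
rewrite /ball_seq iterS mem_cat -/(ball_seq c R) => h.
have [/ih -> //|h'] := leqP (dist c v) R.
have [i ei] : exists i, (dist c (nb v i)).+1 = dist c v by apply: dist_down_nb; lia.
apply/orP; right; apply/flatten_mapP; exists (nb v i); first by apply: ih; lia.
by apply/mapP; exists i; rewrite ?mem_enum ?nbK.
Qed.

Lemma tpath_cons (x y : Vtx n) s : is_tpath x (y :: s) ->
  [/\ adj x y, is_tpath y s & forall z s', s = z :: s' -> x != z].
Proof.
move=> /andP[/= /andP[-> ps] /allP h]; split=> //.
  apply/andP; split=> //; apply/allP => i; rewrite mem_iota add0n => hi.
  rewrite !(set_nth_default x y) /=; try by lia.
  by apply: (h i.+1); rewrite mem_iota /=; lia.
by move=> z s' es; have := h 0; rewrite es mem_iota /=; apply.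
Qed.

(** The absolute difference of j and p, written with truncated subtraction. *)
Definition dd (j p : nat) : nat := (j - p) + (p - j).

(** Once a path moves away from c it can never turn back, because the only neighbour closer to c is
    the vertex it came from. So the distance profile is V-shaped: p is the position nearest to c and
    m the distance there. *)
Lemma tpath_dist c (x : Vtx n) s : is_tpath x s ->
  exists p m, p <= size s /\ forall j, j <= size s -> dist c (nth x (x :: s) j) = m + dd j p.
Proof.
elim: s x => [|y s ih] x.
  by move=> _; exists 0, (dist c x); split=> // j; rewrite leqn0 => /eqP ->; rewrite /dd /=; lia.
move=> /tpath_cons[axy ty hne]; have [p [m [hp h]]] := ih _ ty.
have h0 : dist c y = m + p by rewrite (h 0 isT) /dd; lia.
have [p0|pgt0] := posnP p.
  have [e|e] := dist_adj c axy.
    exists 0, (dist c x); split=> // -[|j] /= hj; first by rewrite /dd; lia.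
    by rewrite (set_nth_default y) //= (h j) // /dd; lia.
  exists 1, m; split=> // -[|j] /= hj; first by rewrite /dd; lia.
  by rewrite (set_nth_default y) //= (h j) // /dd; lia.
case: s ty hp h hne {ih} => [|z s] ty hp h hne; first by move: hp; rewrite /=; lia.
have [ayz _ _] := tpath_cons ty.
have h1 : dist c z = m + dd 1 p by apply: (h 1).
have e : dist c x = (dist c y).+1.
  have [e|//] := dist_adj c axy.
  have /negP[] := hne _ _ erefl; apply/eqP; apply: (@dist_down_uniq c y) => //.
    by rewrite adj_sym.
  by rewrite h1 h0 /dd; lia.
exists p.+1, m; split=> // -[|j] /= hj; first by rewrite /dd; lia.
by rewrite (set_nth_default y) //= (h j) // /dd; lia.
Qed.

Lemma tpath_ball c R (x : Vtx n) s : is_tpath x s -> all (fun v => dist c v <= R) (x :: s) ->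
  size s <= R.*2 /\ (size s = R.*2 ->
    [/\ nth x (x :: s) R = c, dist c x = R & dist c (last x s) = R]).
Proof.
move=> ts /allP hall; have [p [m [hp h]]] := tpath_dist c ts.
have h0 := h 0 (leq0n _); have hl := h (size s) (leqnn _).
have b0 : dist c x <= R by apply: hall; rewrite inE eqxx.
have bl : dist c (last x s) <= R by apply: hall; rewrite mem_last.
rewrite -(nth_last x) /= in bl.
have el : nth x (x :: s) (size s) = last x s by rewrite (last_nth x).
rewrite el in hl; rewrite nth_last in bl; move: h0 hl; rewrite /= /dd => h0 hl.
have bl' : dist c (last x s) <= R by apply: hall; rewrite mem_last.
split; first by lia.
move=> es; have hpR : p = R by lia.
split; [|by lia..].
by apply/eqP; rewrite -dist_eq0 h /dd; lia.
Qed.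

(** The distances to a and a' differ by one, so their sum is twice the distance to the edge plus
    one; the bound 2R+1 describes the neighbourhood of radius R of the edge. *)
Lemma tpath_edge (a a' : Vtx n) R x s : adj a a' -> is_tpath x s ->
  all (fun v => dist a v + dist a' v <= R.*2.+1) (x :: s) ->
  size s <= R.*2.+1 /\ (size s = R.*2.+1 ->
    let u := nth x (x :: s) R in let w := nth x (x :: s) R.+1 in
    ((u == a) && (w == a')) || ((u == a') && (w == a))).
Proof.
move=> aa ts /allP hall.
have el : nth x (x :: s) (size s) = last x s by rewrite (last_nth x).
have [p [m [hp h]]] := tpath_dist a ts.
have [p' [m' [hp' h']]] := tpath_dist a' ts.
have h0 := h 0 (leq0n _); have hl := h (size s) (leqnn _).
have h0' := h' 0 (leq0n _); have hl' := h' (size s) (leqnn _).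
have b0 : dist a x + dist a' x <= R.*2.+1 by apply: hall; rewrite inE eqxx.
have bl : dist a (last x s) + dist a' (last x s) <= R.*2.+1 by apply: hall; rewrite mem_last.
rewrite el in hl hl'.
have d0 := dist_adj_l x aa; have dl := dist_adj_l (last x s) aa.
move: h0 hl h0' hl'; rewrite /= /dd => h0 hl h0' hl'.
split; first by lia.
move=> es.
(* At maximal length both V-profiles reach zero, so a and a' both lie on the path, in the two middle
   positions. *)
have m0 : m = 0 by lia.
have m0' : m' = 0 by lia.
have pa : nth x (x :: s) p = a by apply/eqP; rewrite -dist_eq0 h // /dd; lia.
have pa' : nth x (x :: s) p' = a' by apply/eqP; rewrite -dist_eq0 h' // /dd; lia.
have [[e e']|[e e']] : (p = R /\ p' = R.+1) \/ (p = R.+1 /\ p' = R) by lia.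
  by move: pa pa'; rewrite e e' => /= -> ->; rewrite !eqxx.
by move: pa pa'; rewrite e e' => /= -> ->; rewrite !eqxx orbT.
Qed.

Lemma tpath_fun (p : nat -> Vtx n) m : (forall k, k < m -> adj (p k) (p k.+1)) ->
  (forall k, k.+1 < m -> p k != p k.+2) -> is_tpath (p 0) [seq p k | k <- iota 1 m].
Proof.
move=> ha hn; apply/andP; split.
  apply/(pathP (p 0)) => i; rewrite size_map size_iota => hi.
  have -> : nth (p 0) (p 0 :: [seq p k | k <- iota 1 m]) i = p i.
    by case: i hi => [|i] hi //=; rewrite (nth_map 0) ?size_iota ?nth_iota //; lia.
  by rewrite (nth_map 0) ?size_iota // nth_iota //; apply: ha.
apply/allP => i; rewrite mem_iota size_map size_iota => hi.
have e j : j <= m -> nth (p 0) (p 0 :: [seq p k | k <- iota 1 m]) j = p j.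
  by case: j => [|j] hj //=; rewrite (nth_map 0) ?size_iota ?nth_iota //; lia.
by rewrite !e; try lia; apply: hn; lia.
Qed.

Lemma ray_dist (q : nat -> Vtx n) : (forall k, adj (q k) (q k.+1)) ->
  (forall k, q k != q k.+2) -> forall k, dist (q 0) (q k) = k.
Proof.
move=> ha hn; elim/ltn_ind => -[|k] ih; first by rewrite dist_self.
have e := ih k (ltnSn _).
have [->|e'] := dist_adj (q 0) (ha k); first by rewrite e.
case: k e e' ih => [|k] e e' ih; first by rewrite e in e'.
have := ih k (ltnW (ltnSn _)) => e''.
have /negP[] := hn k; apply/eqP; apply: (@dist_down_uniq (q 0) (q k.+1)) => //.
  by rewrite adj_sym.
by rewrite e e''.
Qed.

Fixpoint ray c (i j : 'I_n) k : Vtx n := if k is k'.+1 then ray (nb c i) j i k' else c.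

Lemma ray_adj c (i j : 'I_n) k : adj (ray c i j k) (ray c i j k.+1).
Proof. by elim: k c i j => [|k ih] c i j; [apply: adj_nb|apply: ih]. Qed.

Lemma ray_ne c (i j : 'I_n) k : i != j -> ray c i j k != ray c i j k.+2.
Proof.
elim: k c i j => [|k ih] c i j ne; last by apply: ih; rewrite eq_sym.
by apply: contraNneq ne => /= e; apply/eqP/(@nb_inj (nb c i)); rewrite nbK -e.
Qed.

End Tree.

(** * Shift functors up to isomorphism *)

Local Open Scope ring_scope.

Section Sigma.
Variables (k : fieldType) (n : nat).
Implicit Types (M N : rep k n) (u v a : Vtx n).

Lemma is_sink_adj o u v : adj u v -> is_sink o v = ~~ is_sink o u.
Proof. by move=> /vodd_adj e; rewrite !is_sinkE e; case: (vodd u); case: o. Qed.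

Lemma is_sink_nb o v i : is_sink o (nb v i) = ~~ is_sink o v.
Proof. exact/is_sink_adj/adj_nb. Qed.

Lemma is_sinkN o v : is_sink (~~ o) v = ~~ is_sink o v.
Proof. by rewrite !is_sinkE; case: (vodd v); case: o. Qed.

(** The universal property of the kernel of the map from the sum of the M_(nb a i) to M_a: the
    composite vanishes, the components are jointly injective, and every family summing to zero
    lifts. Here [g] identifies the neighbouring spaces of N with those of M. *)
Definition kernel_at M N (g : forall v, 'M[k]_(dm N v, dm M v)) a : Prop :=
  [/\ \sum_(i < n) mp N a (nb a i) *m g (nb a i) *m mp M (nb a i) a = 0,
      forall p (W : 'M[k]_(p, dm N a)),
        (forall i, W *m mp N a (nb a i) = 0) -> W = 0 &
      forall p (U : forall i, 'M[k]_(p, dm M (nb a i))),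
        \sum_(i < n) U i *m mp M (nb a i) a = 0 ->
        exists W, forall i, W *m mp N a (nb a i) *m g (nb a i) = U i].

Definition cokernel_at M N (g : forall v, 'M[k]_(dm M v, dm N v)) a : Prop :=
  [/\ \sum_(i < n) mp M a (nb a i) *m g (nb a i) *m mp N (nb a i) a = 0,
      forall p (U : forall i, 'M[k]_(p, dm M (nb a i))),
        \sum_(i < n) U i *m g (nb a i) *m mp N (nb a i) a = 0 ->
        exists W, forall i, U i = W *m mp M a (nb a i) &
      forall p (W : 'M[k]_(p, dm N a)),
        exists U : forall i, 'M[k]_(p, dm M (nb a i)),
          W = \sum_(i < n) U i *m g (nb a i) *m mp N (nb a i) a].

(** N is a shift of M up to isomorphism. The relation also covers representations that are not
    literally of the form [sigma M], in particular M as a shift of sigma^- M. *)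
Definition is_sigma M N : Prop :=
  ori N = ~~ ori M /\
  exists (g : forall v, 'M[k]_(dm N v, dm M v)) (h : forall v, 'M[k]_(dm M v, dm N v)),
  forall v, (~~ is_sink (ori M) v -> g v *m h v = 1%:M /\ h v *m g v = 1%:M) /\
            (is_sink (ori M) v -> kernel_at g v).

Definition is_sigmam M N : Prop :=
  ori N = ~~ ori M /\
  exists (g : forall v, 'M[k]_(dm M v, dm N v)) (h : forall v, 'M[k]_(dm N v, dm M v)),
  forall v, (is_sink (ori M) v -> g v *m h v = 1%:M /\ h v *m g v = 1%:M) /\
            (~~ is_sink (ori M) v -> cokernel_at g v).

(** Dimensions of shifted spaces agree only propositionally; [pid_mx] serves as the identity matrix
    between two spaces of equal dimension. *)
Lemma pid_mx_castK p q : p = q -> (pid_mx p : 'M[k]_(p, q)) *m pid_mx q = 1%:M :> 'M_p.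
Proof. by move=> ->; rewrite pid_mx_1 mulmx1. Qed.

Lemma conform_mxE p q p' q' (A : 'M[k]_(q, q')) : p = q -> p' = q' ->
  conform_mx (0 : 'M[k]_(p, p')) A = pid_mx p *m A *m pid_mx q'.
Proof.
by move=> e e'; subst q q'; rewrite conform_mx_id !pid_mx_1 mul1mx mulmx1.
Qed.

Lemma sum_nb_eq p q a (j : 'I_n) (F : 'I_n -> 'M[k]_(p, q)) :
  \sum_(i < n | nb a i == nb a j) F i = F j.
Proof. by rewrite (big_pred1 j) // => i; rewrite (inj_eq (@nb_inj n a)). Qed.

Lemma sigma_dm_source M v : ~~ is_sink (ori M) v -> sigma_dm M v = dm M v.
Proof. by rewrite /sigma_dm => /negPf ->. Qed.

Lemma sigma_mpE M a i : is_sink (ori M) a ->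
  sigma_mp M a (nb a i) =
  pid_mx (sigma_dm M a) *m submxrow (sink_ker M a) i *m pid_mx (dm M (nb a i)).
Proof.
move=> sa; have ea : sigma_dm M a = \rank (kermx (sink_map M a)).
  by rewrite /sigma_dm sa.
have eb : sigma_dm M (nb a i) = dm M (nb a i).
  by rewrite sigma_dm_source // is_sink_nb sa.
by rewrite /sigma_mp sum_nb_eq conform_mx_id conform_mxE.
Qed.

Lemma submxrow_mul p m (q : 'I_n -> nat) (B : 'M[k]_(p, m)) (A : 'M[k]_(m, \sum_i q i)) i :
  submxrow (B *m A) i = B *m submxrow A i.
Proof. by apply/matrixP=> x y; rewrite !mxE; apply: eq_bigr => z _; rewrite !mxE. Qed.

Lemma sigma_spec M : is_sigma M (sigma M).
Proof.
split=> //.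
exists (fun v => pid_mx (sigma_dm M v)), (fun v => pid_mx (dm M v)) => v; split.
  move=> sv; have e := sigma_dm_source sv.
  by rewrite (pid_mx_castK e) (pid_mx_castK (esym e)).
move=> sa; have ea : sigma_dm M v = \rank (kermx (sink_map M v)).
  by rewrite /sigma_dm sa.
have eb i : sigma_dm M (nb v i) = dm M (nb v i).
  by rewrite sigma_dm_source // is_sink_nb sa.
have E p (W : 'M[k]_(p, sigma_dm M v)) i :
    W *m sigma_mp M v (nb v i) *m pid_mx (sigma_dm M (nb v i)) =
    submxrow (W *m pid_mx (sigma_dm M v) *m sink_ker M v) i.
  by rewrite sigma_mpE // [RHS]submxrow_mul -!mulmxA (pid_mx_castK (esym (eb i))) mulmx1.
have kA : sink_ker M v *m sink_map M v = 0.
  by apply/sub_kermxP; rewrite /sink_ker eq_row_base.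
split.
- have -> : \sum_(i < n) mp (sigma M) v (nb v i) *m pid_mx (sigma_dm M (nb v i)) *m mp M (nb v i) v
     = 1%:M *m pid_mx (sigma_dm M v) *m sink_ker M v *m sink_map M v.
    rewrite -[X in _ = X *m _]submxrowK /sink_map mul_mxrow_mxcol; apply: eq_bigr => i _.
    by rewrite -E mul1mx.
  by rewrite -mulmxA kA mulmx0.
- move=> p W W0.
  have : W *m pid_mx (sigma_dm M v) *m sink_ker M v = 0.
    by apply/mxrowP => i; rewrite submxrow0 -E W0 mul0mx.
  move/eqP; rewrite mulmx_free_eq0 ?row_base_free // => /eqP e.
  by rewrite -[W]mulmx1 -(pid_mx_castK ea) mulmxA e mul0mx.
move=> p U U0.
have sub : (\mxrow_i U i <= sink_ker M v)%MS.
  by rewrite /sink_ker eq_row_base; apply/sub_kermxP; rewrite /sink_map mul_mxrow_mxcol.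
exists ((\mxrow_i U i) *m pinvmx (sink_ker M v) *m pid_mx (\rank (kermx (sink_map M v)))) => i.
rewrite E -[_ *m pid_mx _ *m pid_mx _]mulmxA (pid_mx_castK (esym ea)) mulmx1.
by rewrite mulmxKpV // mxrowK.
Qed.

Lemma sigmam_dm_sink M v : is_sink (ori M) v -> sigmam_dm M v = dm M v.
Proof. by rewrite /sigmam_dm => ->. Qed.

Lemma sigmam_mpE M a i : ~~ is_sink (ori M) a ->
  sigmam_mp M (nb a i) a =
  pid_mx (sigmam_dm M (nb a i)) *m submxcol (source_coker M a) i
    *m pid_mx (\rank (cokermx (source_map M a))).
Proof.
move=> sa; have ea : sigmam_dm M a = \rank (cokermx (source_map M a)).
  by rewrite /sigmam_dm sa.
have eb : sigmam_dm M (nb a i) = dm M (nb a i).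
  by rewrite sigmam_dm_sink // is_sink_nb sa.
by rewrite /sigmam_mp sum_nb_eq conform_mx_id conform_mxE.
Qed.

Lemma sigmam_spec M : is_sigmam M (sigmam M).
Proof.
split=> //.
exists (fun v => pid_mx (dm M v)), (fun v => pid_mx (sigmam_dm M v)) => v; split.
  move=> sv; have e := sigmam_dm_sink sv.
  by rewrite (pid_mx_castK e) (pid_mx_castK (esym e)).
move=> sa; have ea : sigmam_dm M v = \rank (cokermx (source_map M v)).
  by rewrite /sigmam_dm sa.
have eb i : sigmam_dm M (nb v i) = dm M (nb v i).
  by rewrite sigmam_dm_sink // is_sink_nb sa.
pose J : 'M[k]_(\rank (cokermx (source_map M v)), sigmam_dm M v) := pid_mx (\rank (cokermx (source_map M v))).
have E p (U : forall i, 'M[k]_(p, dm M (nb v i))) :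
    \sum_(i < n) U i *m pid_mx (dm M (nb v i)) *m sigmam_mp M (nb v i) v =
    (\mxrow_i U i) *m source_coker M v *m J.
  rewrite -[source_coker M v]submxcolK mul_mxrow_mxcol mulmx_suml.
  apply: eq_bigr => i _; rewrite sigmam_mpE // !mulmxA -(mulmxA (U i)).
  by rewrite (pid_mx_castK (esym (eb i))) mulmx1.
have kerC p (A : 'M[k]_(p, _)) : A *m source_coker M v = 0 -> (A <= source_map M v)%MS.
  by move=> A0; rewrite submxE -(mulmx_base (cokermx _)) mulmxA A0 mul0mx.
split.
- have := E _ (fun i => mp M v (nb v i)).
  rewrite -/(source_map M v) /= => ->.
  have -> : source_map M v *m source_coker M v = 0; last by rewrite mul0mx.
  apply/eqP; rewrite -(mulmx_free_eq0 _ (row_base_free (cokermx (source_map M v)))).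
  by rewrite -mulmxA mulmx_base mulmx_coker.
- move=> p U; rewrite E => e0.
  have := congr1 (fun A => A *m pid_mx (sigmam_dm M v) : 'M_(_, \rank (cokermx (source_map M v)))) e0.
  rewrite /= mul0mx -mulmxA /J (pid_mx_castK (esym ea)) mulmx1 => /kerC /submxP[W e].
  exists W => i; have := congr1 (fun A => submxrow A i) e.
  by rewrite /source_map mxrowK submxrow_mul mxrowK.
move=> p W.
have /row_fullP[B BC] : row_full (source_coker M v) by apply: col_base_full.
exists (fun i => submxrow (W *m pid_mx (sigmam_dm M v) *m B) i).
by rewrite E submxrowK -(mulmxA _ B) BC mulmx1 -mulmxA (pid_mx_castK ea) mulmx1.
Qed.

(** If the maps out of each source v are jointly injective, then M_v, the sum over the neighbours
    and the cokernel form a short exact sequence, so the kernel of the cokernel projection is M_v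
    again. *)
Lemma sigmam_sigma M N : is_sigmam M N ->
  (forall v, ~~ is_sink (ori M) v -> forall p (W : 'M[k]_(p, dm M v)),
     (forall i, W *m mp M v (nb v i) = 0) -> W = 0) ->
  is_sigma N M.
Proof.
move=> [eo [g [h gh]]] inj; split; first by rewrite eo negbK.
exists g, h => v; rewrite eo is_sinkN negbK; split; first by have [] := gh v.
move=> sv; have [_ /(_ sv)[z ex _]] := gh v; split=> // [|p U U0]; first exact: inj.
have gK i : h (nb v i) *m g (nb v i) = 1%:M.
  by have [hs _] := gh (nb v i); have [|_ ->] := hs; rewrite ?is_sink_nb.
have [|W eW] := ex p (fun i => U i *m h (nb v i)).
  by rewrite -[RHS]U0; apply: eq_bigr => i _; rewrite -!mulmxA (mulmxA (h _)) gK mul1mx.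
by exists W => i; rewrite -eW -mulmxA gK mulmx1.
Qed.

End Sigma.

(** * Local behaviour of the shifts: surjectivity, injectivity, supports, restriction to vertex
    sets *)

Section Local.
Variables (k : fieldType) (n : nat).
Implicit Types (M N : rep k n) (u v a : Vtx n).

Lemma arrowP o u v : reflect (exists2 i, v = nb u i & ~~ is_sink o u) (arrow o u v).
Proof.
apply: (iffP andP) => [[/adjP[i ->] s]|[i -> s]]; first by exists i; rewrite // -(is_sink_nb _ _ i).
by rewrite adj_nb is_sink_nb.
Qed.

Lemma single_family p (q : 'I_n -> nat) i (T : 'M[k]_(p, q i)) :
  exists d : forall j, 'M[k]_(p, q j), d i = T /\ forall j, j != i -> d j = 0.
Proof.
exists (fun j => if j == i then conform_mx 0 T else 0).
by rewrite eqxx conform_mx_id; split=> // j /negPf ->.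
Qed.

Lemma sum_single p q (F : 'I_n -> 'M[k]_(p, q)) i :
  (forall j, j != i -> F j = 0) -> \sum_j F j = F i.
Proof. by move=> h; rewrite (bigD1 i) //= big1 ?addr0. Qed.

Lemma scalar_mx1_eq0 m : (1%:M : 'M[k]_m) = 0 -> m = 0%N.
Proof. by move=> e; have := mxrank1 k m; rewrite e mxrank0. Qed.

(* Joint surjectivity of the maps into a other than the i-th one. *)
Definition jsurj M a i := exists2 c : forall j, 'M[k]_(dm M a, dm M (nb a j)),
  c i = 0 & \sum_j c j *m mp M (nb a j) a = 1%:M.

Definition jinj M v i := forall p (w : 'M[k]_(p, dm M v)),
  (forall j, j != i -> w *m mp M v (nb v j) = 0) -> w = 0.

Lemma row_full_jsurj M a i j : i != j -> row_full (mp M (nb a j) a) -> jsurj M a i.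
Proof.
move=> ne /row_fullP[B BA].
have [d [dj dn]] := @single_family (dm M a) (fun j => dm M (nb a j)) j B.
exists d; first exact: dn.
by rewrite (sum_single (i := j)) ?dj // => l /dn ->; rewrite mul0mx.
Qed.

Lemma row_free_jinj M v i j : i != j -> row_free (mp M v (nb v j)) -> jinj M v i.
Proof.
move=> ne rf p w /(_ j); rewrite eq_sym => /(_ ne) /eqP.
by rewrite mulmx_free_eq0 // => /eqP.
Qed.

(** The image in M_a of an element of M_(nb a i) is also reached from the other neighbours. The
    difference of the two families lies in the kernel and has the given element as its i-th
    component. *)
Lemma jsurj_sigma M N a i : is_sigma M N -> is_sink (ori M) a ->
  jsurj M a i -> row_full (mp N a (nb a i)).
Proof.
move=> [eo [g [h gh]]] sa [c ci ce]; apply/row_fullP.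
have [_ /(_ sa)[z inj ex]] := gh a.
have [d [di dn]] := @single_family _ (fun j => dm M (nb a j)) i (g (nb a i)).
have [|W eW] := ex _ (fun j => d j - g (nb a i) *m mp M (nb a i) a *m c j).
  under eq_bigr do rewrite mulmxBl.
  rewrite big_split /= (sum_single (i := i)) => [|j /dn ->]; last by rewrite mul0mx.
  rewrite di sumrN; apply/eqP; rewrite subr_eq0; apply/eqP.
  rewrite -[LHS]mulmx1 -ce mulmx_sumr; apply: eq_bigr => j _.
  by rewrite !mulmxA.
exists W; have [hs _] := gh (nb a i); have [|e _] := hs; first by rewrite is_sink_nb sa.
by rewrite -[LHS]mulmx1 -e mulmxA eW di ci mulmx0 subr0.
Qed.

(** An element of the i-th summand that dies in the cokernel is the image of some Z in M_v whose
    other components all vanish; joint injectivity gives Z = 0. *)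
Lemma jinj_sigmam M N v i : is_sigmam M N -> ~~ is_sink (ori M) v ->
  jinj M v i -> row_free (mp N (nb v i) v).
Proof.
move=> [eo [g [h gh]]] sv ji; apply: inj_row_free => u u0.
have [_ /(_ sv)[z ex _]] := gh v.
have [hs _] := gh (nb v i); have [|e e'] := hs; first by rewrite is_sink_nb.
have [d [di dn]] := @single_family _ (fun j => dm M (nb v j)) i (u *m h (nb v i)).
have [|Z eZ] := ex _ d.
  rewrite (sum_single (i := i)) => [|j /dn ->]; last by rewrite !mul0mx.
  by rewrite di -(mulmxA u) e' mulmx1.
have Z0 : Z = 0 by apply: ji => j /dn; rewrite eZ.
by rewrite -[u]mulmx1 -e' mulmxA -di eZ Z0 !mul0mx.
Qed.

Lemma sigma_row_full M a u u' : is_sink (ori M) a -> adj a u -> adj a u' -> u != u' ->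
  row_full (mp M u' a) -> row_full (mp (sigma M) a u).
Proof.
move=> sa /adjP[i ->] /adjP[j ->] ne rf; apply: (jsurj_sigma (sigma_spec M)) => //.
by apply: row_full_jsurj rf; apply: contraNneq ne => ->.
Qed.

Lemma sigmam_row_free M v u u' : ~~ is_sink (ori M) v -> adj v u -> adj v u' -> u != u' ->
  row_free (mp M v u') -> row_free (mp (sigmam M) u v).
Proof.
move=> sa /adjP[i ->] /adjP[j ->] ne rf; apply: (jinj_sigmam (sigmam_spec M)) => //.
by apply: row_free_jinj rf; apply: contraNneq ne => ->.
Qed.

Lemma sigma_dm_sink0 M v : is_sink (ori M) v -> (forall i, dm M (nb v i) = 0%N) ->
  dm (sigma M) v = 0%N.
Proof.
move=> sv z; have [_ [g [h gh]]] := sigma_spec M.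
have [_ /(_ sv)[_ inj _]] := gh v.
apply/scalar_mx1_eq0/inj => i.
have e : dm (sigma M) (nb v i) = 0%N by rewrite /= sigma_dm_source ?is_sink_nb ?sv.
by move: (1%:M *m _); rewrite e => A; apply: thinmx0.
Qed.

Lemma sigmam_dm_source0 M v : ~~ is_sink (ori M) v -> (forall i, dm M (nb v i) = 0%N) ->
  dm (sigmam M) v = 0%N.
Proof.
move=> sv z; have [_ [g [h gh]]] := sigmam_spec M.
have [_ /(_ sv)[_ _ sj]] := gh v.
apply: scalar_mx1_eq0; have [U ->] := sj _ 1%:M; apply: big1 => i _.
suff -> : U i = 0 by rewrite !mul0mx.
by move: (U i); rewrite z => A; apply: thinmx0.
Qed.

Lemma row_full_pos p q (A : 'M[k]_(p, q)) : row_full A -> (0 < q)%N -> (0 < p)%N.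
Proof. by move=> /eqP e h; apply: leq_trans h _; rewrite -e rank_leq_row. Qed.

Lemma row_free_pos p q (A : 'M[k]_(p, q)) : row_free A -> (0 < p)%N -> (0 < q)%N.
Proof. by move=> /eqP e h; apply: leq_trans h _; rewrite -e rank_leq_col. Qed.

Lemma sigma_supp M v : is_sink (ori M) v -> (0 < dm (sigma M) v)%N ->
  exists i, (0 < dm M (nb v i))%N.
Proof.
move=> sv; have [/existsP h _|] := boolP [exists i, 0 < dm M (nb v i)]%N; first exact: h.
rewrite negb_exists => /forallP h; rewrite sigma_dm_sink0 // => i.
by apply/eqP; rewrite -leqn0 leqNgt h.
Qed.

Lemma sigmam_supp M v : ~~ is_sink (ori M) v -> (0 < dm (sigmam M) v)%N ->
  exists i, (0 < dm M (nb v i))%N.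
Proof.
move=> sv; have [/existsP h _|] := boolP [exists i, 0 < dm M (nb v i)]%N; first exact: h.
rewrite negb_exists => /forallP h; rewrite sigmam_dm_source0 // => i.
by apply/eqP; rewrite -leqn0 leqNgt h.
Qed.

Lemma inv_dm p q (A : 'M[k]_(p, q)) (B : 'M[k]_(q, p)) :
  A *m B = 1%:M -> B *m A = 1%:M -> p = q.
Proof. by move=> /mulmx1_min h /mulmx1_min h'; apply/eqP; rewrite eqn_leq h h'. Qed.

Definition iso_on (Om : Vtx n -> Prop) M N : Prop :=
  ori M = ori N /\
  exists (f : forall v, 'M[k]_(dm M v, dm N v)) (f' : forall v, 'M[k]_(dm N v, dm M v)),
  (forall v, Om v -> f v *m f' v = 1%:M /\ f' v *m f v = 1%:M) /\
  (forall a b, arrow (ori M) a b -> Om a -> Om b -> f a *m mp N a b = mp M a b *m f b).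

Lemma iso_on_dm Om M N v : iso_on Om M N -> Om v -> dm M v = dm N v.
Proof. by move=> [_ [f [f' [h _]]]] /h[]; apply: inv_dm. Qed.

Lemma iso_on_row_free Om M N a b : iso_on Om M N -> arrow (ori M) a b -> Om a -> Om b ->
  row_free (mp N a b) -> row_free (mp M a b).
Proof.
move=> [_ [f [f' [h c]]]] ab oa ob /row_freeP[B e]; apply/row_freeP.
exists (f b *m B *m f' a); rewrite !mulmxA -c // -(mulmxA (f a)) e mulmx1.
by have [] := h a oa.
Qed.

Lemma iso_on_row_full Om M N a b : iso_on Om M N -> arrow (ori M) a b -> Om a -> Om b ->
  row_full (mp N a b) -> row_full (mp M a b).
Proof.
move=> [_ [f [f' [h c]]]] ab oa ob /row_fullP[B e]; apply/row_fullP.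
have [eb _] := h b ob; have [ea _] := h a oa.
exists (f b *m B *m f' a); rewrite -[LHS]mulmx1 -eb mulmxA -(mulmxA _ (mp M a b)) -c //.
by rewrite !mulmxA -(mulmxA _ (f' a)) (h a oa).2 mulmx1 -(mulmxA _ B) e mulmx1 eb.
Qed.

Lemma kernel_lift M N M' N' v (gM : forall v, 'M[k]_(dm M' v, dm M v))
    (gN : forall v, 'M[k]_(dm N' v, dm N v))
    (f : forall v, 'M[k]_(dm M v, dm N v)) :
  kernel_at gM v -> kernel_at gN v ->
  (forall i, f (nb v i) *m mp N (nb v i) v = mp M (nb v i) v *m f v) ->
  exists F : 'M[k]_(dm M' v, dm N' v), forall i,
    F *m mp N' v (nb v i) *m gN (nb v i) = mp M' v (nb v i) *m gM (nb v i) *m f (nb v i).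
Proof.
move=> [zM _ _] [_ _ exN] c.
apply: (exN _ (fun i => mp M' v (nb v i) *m gM (nb v i) *m f (nb v i))).
under eq_bigr do rewrite -mulmxA c mulmxA.
by rewrite -mulmx_suml zM mul0mx.
Qed.

Lemma kernel_lift_inv M N M' N' v (gM : forall v, 'M[k]_(dm M' v, dm M v))
    (hM : forall v, 'M[k]_(dm M v, dm M' v))
    (gN : forall v, 'M[k]_(dm N' v, dm N v))
    (f : forall v, 'M[k]_(dm M v, dm N v)) (f' : forall v, 'M[k]_(dm N v, dm M v))
    (F : 'M[k]_(dm M' v, dm N' v)) (F' : 'M[k]_(dm N' v, dm M' v)) :
  kernel_at gM v -> (forall i, gM (nb v i) *m hM (nb v i) = 1%:M) ->
  (forall i, f (nb v i) *m f' (nb v i) = 1%:M) ->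
  (forall i, F *m mp N' v (nb v i) *m gN (nb v i) = mp M' v (nb v i) *m gM (nb v i) *m f (nb v i)) ->
  (forall i, F' *m mp M' v (nb v i) *m gM (nb v i) = mp N' v (nb v i) *m gN (nb v i) *m f' (nb v i)) ->
  F *m F' = 1%:M.
Proof.
move=> [_ inj _] gh ff e e'; apply/eqP; rewrite -subr_eq0; apply/eqP/inj => i.
rewrite -[LHS]mulmx1 -(gh i) mulmxA mulmxBl mulmxBl mul1mx.
by rewrite -!(mulmxA F) e' !mulmxA e -(mulmxA _ (f _)) ff mulmx1 subrr mul0mx.
Qed.

(** A reflected space is a kernel formed from the vertex and its neighbours, so an isomorphism there
    induces one of the kernels; the two induced maps are inverse by uniqueness of lifts. *)
Lemma iso_on_sigma (Om Om' : Vtx n -> Prop) M N M' N' :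
  iso_on Om M N -> is_sigma M M' -> is_sigma N N' ->
  (forall v, Om' v -> Om v /\ (is_sink (ori M) v -> forall i, Om (nb v i))) ->
  iso_on Om' M' N'.
Proof.
move=> [eo [f [f' [ff fc]]]] [oM [gM [hM ghM]]] [oN [gN [hN ghN]]] sub.
split; first by rewrite oM oN eo.
(* Existence is proved vertex by vertex and turned into a family by choice. At a sink outside [Om']
   the chosen value is an irrelevant zero. *)
have [F HF] : {F : forall v, 'M[k]_(dm M' v, dm N' v) * 'M[k]_(dm N' v, dm M' v) |
  forall v, Om' v -> [/\ (F v).1 *m (F v).2 = 1%:M, (F v).2 *m (F v).1 = 1%:M,
     ~~ is_sink (ori M) v -> (F v).1 = gM v *m f v *m hN v &
     is_sink (ori M) v -> forall i, (F v).1 *m mp N' v (nb v i) *m gN (nb v i) =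
        mp M' v (nb v i) *m gM (nb v i) *m f (nb v i)]}.
  suff H v : exists F : 'M[k]_(dm M' v, dm N' v) * 'M[k]_(dm N' v, dm M' v),
    Om' v -> [/\ F.1 *m F.2 = 1%:M, F.2 *m F.1 = 1%:M,
     ~~ is_sink (ori M) v -> F.1 = gM v *m f v *m hN v &
     is_sink (ori M) v -> forall i, F.1 *m mp N' v (nb v i) *m gN (nb v i) =
        mp M' v (nb v i) *m gM (nb v i) *m f (nb v i)].
    exists (fun v => proj1_sig (constructive_indefinite_description _ (H v))) => v.
    exact: (proj2_sig (constructive_indefinite_description _ (H v))).
  have [sv|sv] := boolP (is_sink (ori M) v); last first.
    exists (gM v *m f v *m hN v, gN v *m f' v *m hM v) => /sub[ov _] /=.
    have [f1 f2] := ff v ov.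
    have [/(_ sv)[m1 m2] _] := ghM v; have [hn _] := ghN v.
    have [|n1 n2] := hn; first by rewrite -eo.
    split=> //; rewrite !mulmxA.
      by rewrite -(mulmxA _ (hN v)) n2 mulmx1 -(mulmxA _ (f v)) f1 mulmx1.
    by rewrite -(mulmxA _ (hM v)) m2 mulmx1 -(mulmxA _ (f' v)) f2 mulmx1.
  have [kM kN] : kernel_at gM v /\ kernel_at gN v.
    by split; [have [_] := ghM v | have [_] := ghN v; rewrite -eo]; apply.
  have sn i : ~~ is_sink (ori M) (nb v i) by rewrite is_sink_nb sv.
  have ar i : arrow (ori M) (nb v i) v by rewrite /arrow adj_sym adj_nb sv.
  case: (classic (Om' v)) => [ov'|no]; last by exists (0, 0).
  have [ov /(_ sv) on] := sub v ov'.
  have fc' i : f' (nb v i) *m mp M (nb v i) v = mp N (nb v i) v *m f' v.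
    have [f1 f2] := ff v ov; have [f1' f2'] := ff _ (on i).
    rewrite -[LHS]mulmx1 -f1 !mulmxA -(mulmxA (f' _)) -fc //.
    by rewrite !mulmxA f2' mul1mx.
  have [F eF] := kernel_lift kM kN (fun i => fc _ _ (ar i) (on i) ov).
  have [F' eF'] := kernel_lift kN kM fc'.
  exists (F, F') => _; split=> //=.
    apply: (kernel_lift_inv (hM := hM) kM _ _ eF eF') => i.
      by have [/(_ (sn i))[]] := ghM (nb v i).
    by have [] := ff _ (on i).
  apply: (kernel_lift_inv (hM := hN) kN _ _ eF' eF) => i.
    by have [hn _] := ghN (nb v i); rewrite -eo in hn; have [] := hn (sn i).
  by have [] := ff _ (on i).
exists (fun v => (F v).1), (fun v => (F v).2); split=> [v /HF[]//|a b].
rewrite oM => /arrowP[i -> ]; rewrite is_sinkN negbK => sa oa ob.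
have [_ _ _ /(_ sa) /(_ i) e] := HF a oa; have [_ _ e' _] := HF _ ob.
have sn : ~~ is_sink (ori M) (nb a i) by rewrite is_sink_nb sa.
have [hn _] := ghN (nb a i); rewrite -eo in hn; have [n1 n2] := hn sn.
by rewrite (e' sn) !mulmxA -e -(mulmxA _ (gN _)) n1 mulmx1.
Qed.

End Local.

(** * Transport of indecomposability *)

Section Indec.
Variables (k : fieldType) (n : nat).
Implicit Types (M N : rep k n) (v a : Vtx n).

Section Transport.
Variables (M N : rep k n).
Variables (g : forall v, 'M[k]_(dm N v, dm M v)) (h : forall v, 'M[k]_(dm M v, dm N v)).
Hypothesis oN : ori N = ~~ ori M.
Hypothesis gh : forall v, ~~ is_sink (ori M) v -> g v *m h v = 1%:M /\ h v *m g v = 1%:M.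
Hypothesis ker : forall v, is_sink (ori M) v -> dm N v = 0%N \/ kernel_at g v.
Hypothesis sur : forall v, is_sink (ori M) v ->
  exists U : forall i, 'M[k]_(dm M v, dm M (nb v i)),
    \sum_i U i *m mp M (nb v i) v = 1%:M.

(** The family of subspaces of N induced by U: at a sink of M, the kernel elements all of whose
    components lie in U; at a source, U carried over by the identification. *)
Definition trans (U : forall v, 'M[k]_(dm M v)) v : 'M[k]_(dm N v) :=
  if is_sink (ori M) v
  then (\bigcap_i kermx (mp N v (nb v i) *m g (nb v i) *m cokermx (U (nb v i))))%MS
  else g v *m U v *m h v.

Lemma trans_source U v p (A : 'M[k]_(p, dm N v)) : ~~ is_sink (ori M) v ->
  (A <= trans U v)%MS = (A *m g v <= U v)%MS.
Proof.
move=> sv; have [e e'] := gh sv; rewrite /trans (negPf sv); apply/idP/idP => s.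
  apply: submx_trans (submxMr (g v) s) _.
  by rewrite -!mulmxA e' mulmx1 submxMl.
have -> : A = A *m g v *m h v by rewrite -mulmxA e mulmx1.
apply: submx_trans (submxMr (h v) s) _.
have -> : U v *m h v = h v *m (g v *m U v *m h v) by rewrite !mulmxA e' mul1mx.
exact: submxMl.
Qed.

Lemma trans_sink U v p (A : 'M[k]_(p, dm N v)) : is_sink (ori M) v ->
  (A <= trans U v)%MS <-> forall i, (A *m mp N v (nb v i) *m g (nb v i) <= U (nb v i))%MS.
Proof.
move=> sv; rewrite /trans sv; split.
  move=> /sub_bigcapmxP s i; rewrite submxE -!mulmxA; apply/eqP/sub_kermxP.
  by rewrite mulmxA; apply: s.
move=> s; apply/sub_bigcapmxP => i _; apply/sub_kermxP.
by rewrite mulmxA (mulmxA A); apply/eqP; rewrite -submxE.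
Qed.

Lemma trans_arrow U a b : arrow (ori N) a b -> (trans U a *m mp N a b <= trans U b)%MS.
Proof.
rewrite oN => /arrowP[i ->]; rewrite is_sinkN negbK => sa.
rewrite trans_source ?is_sink_nb ?sa //.
by have /trans_sink -> := submx_refl (trans U a).
Qed.

Lemma nb_inv v i : is_sink (ori M) v -> g (nb v i) *m h (nb v i) = 1%:M.
Proof. by move=> sv; have [|] := @gh (nb v i); rewrite ?is_sink_nb ?sv. Qed.

Lemma trans_cap U W : (forall v, ((U v :&: W v)%MS == 0)) ->
  forall v, ((trans U v :&: trans W v)%MS == 0).
Proof.
move=> uw v; have [sv|sv] := boolP (is_sink (ori M) v).
  have [e|[_ inj _]] := ker sv; first by apply/eqP; move: (_ :&: _)%MS; rewrite e => A; apply: thinmx0.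
  apply/eqP/inj => i; rewrite -[LHS]mulmx1 -(nb_inv i sv) mulmxA.
  set X := (_ :&: _)%MS.
  have /trans_sink s1 : (X <= trans U v)%MS by apply: capmxSl.
  have /trans_sink s2 : (X <= trans W v)%MS by apply: capmxSr.
  have : (X *m mp N v (nb v i) *m g (nb v i) <= U (nb v i) :&: W (nb v i))%MS.
    by rewrite sub_capmx s1 // s2.
  by rewrite (eqP (uw _)) submx0 => /eqP ->; rewrite mul0mx.
set X := (_ :&: _)%MS.
have : (X *m g v <= U v :&: W v)%MS.
  by rewrite sub_capmx -!trans_source // capmxSl capmxSr.
rewrite (eqP (uw _)) submx0 => /eqP e.
by rewrite -[X]mulmx1 -(gh sv).1 mulmxA e mul0mx.
Qed.

(** Split every component of a kernel element along U and W. The two partial sums in M_v lie in U_v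
    and W_v and add up to zero, so each vanishes and both halves are again in the kernel. *)
Lemma trans_add U W : (forall v, ((U v :&: W v)%MS == 0)) ->
  (forall v, (1%:M <= U v + W v)%MS) ->
  (forall a b, arrow (ori M) a b -> (U a *m mp M a b <= U b)%MS) ->
  (forall a b, arrow (ori M) a b -> (W a *m mp M a b <= W b)%MS) ->
  forall v, (1%:M <= trans U v + trans W v)%MS.
Proof.
move=> uw uw1 su sw v.
have uw0 v' : (U v' :&: W v')%MS = 0 by apply/eqP.
have wu0 v' : (W v' :&: U v')%MS = 0 by rewrite capmxC.
have in1 p v' (A : 'M[k]_(p, dm M v')) : (A <= U v' + W v')%MS.
  exact: submx_trans (submx1 _) (uw1 _).
have [sv|sv] := boolP (is_sink (ori M) v); last first.
  have [e e'] := gh sv.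
  have -> : 1%:M = g v *m proj_mx (U v) (W v) *m h v + g v *m proj_mx (W v) (U v) *m h v.
    by rewrite -mulmxDl add_proj_mx.
  apply: addmx_sub_adds; rewrite trans_source // -mulmxA e' mulmx1; exact: proj_mx_sub.
have [e|kv] := ker sv.
  by rewrite (_ : 1%:M = 0) ?sub0mx //; move: (1%:M); rewrite e => A; apply: thinmx0.
have [z inj ex] := kv.
pose c i := mp N v (nb v i) *m g (nb v i).
pose A i := c i *m proj_mx (U (nb v i)) (W (nb v i)).
pose B i := c i *m proj_mx (W (nb v i)) (U (nb v i)).
have cAB i : A i + B i = c i by apply: add_proj_mx.
have ar i : arrow (ori M) (nb v i) v by rewrite /arrow adj_sym adj_nb sv.
have sA : ((\sum_i A i *m mp M (nb v i) v)%R <= U v)%MS.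
  apply: summx_sub => i _; apply: (submx_trans _ (su _ _ (ar i))).
  exact/submxMr/proj_mx_sub.
have sB : ((\sum_i B i *m mp M (nb v i) v)%R <= W v)%MS.
  apply: summx_sub => i _; apply: (submx_trans _ (sw _ _ (ar i))).
  exact/submxMr/proj_mx_sub.
have AB0 : \sum_i A i *m mp M (nb v i) v + \sum_i B i *m mp M (nb v i) v = 0.
  rewrite -big_split /= -[RHS]z; apply: eq_bigr => i _.
  by rewrite -mulmxDl cAB.
have A0 : \sum_i A i *m mp M (nb v i) v = 0.
  apply/eqP; rewrite -submx0 -(uw0 v) sub_capmx sA /=.
  by rewrite (_ : \sum_i _ = - \sum_i B i *m mp M (nb v i) v) ?eqmx_opp //; apply/eqP; rewrite -addr_eq0 AB0.
have B0 : \sum_i B i *m mp M (nb v i) v = 0 by move: AB0; rewrite A0 add0r.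
have [A' eA] := ex _ _ A0; have [B' eB] := ex _ _ B0.
have -> : 1%:M = A' + B'.
  apply/eqP; rewrite -subr_eq0; apply/eqP/inj => i.
  rewrite -[LHS]mulmx1 -(nb_inv i sv) mulmxA mulmxBl mulmxBl !mulmxDl eA eB cAB mul1mx -/(c i).
  by rewrite -mulmxDl subrr mul0mx.
apply: addmx_sub_adds; apply/trans_sink => // i; rewrite ?eA ?eB; exact: proj_mx_sub.
Qed.

(** If U vanished at all neighbours of a sink v, W would contain all of their spaces, hence by joint
    surjectivity all of M_v, forcing U_v = 0. So a nonzero U is nonzero at some source, where
    [trans] preserves it. *)
Lemma trans_neq0 (U W : forall v, 'M[k]_(dm M v)) : (forall v, ((U v :&: W v)%MS == 0)) ->
  (forall v, (1%:M <= U v + W v)%MS) ->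
  (forall a b, arrow (ori M) a b -> (W a *m mp M a b <= W b)%MS) ->
  (exists v, U v != 0) -> exists v, trans U v != 0.
Proof.
move=> uw uw1 sw [v nz].
suff [v' sv' nz'] : exists2 v', ~~ is_sink (ori M) v' & U v' != 0.
  exists v'; apply: contraNneq nz' => e.
  have : (U v' *m h v' <= trans U v')%MS.
    by rewrite trans_source // -mulmxA (gh sv').2 mulmx1.
  rewrite e submx0 => /eqP e'.
  by rewrite -[U v']mulmx1 -(gh sv').2 mulmxA e' mul0mx.
have [sv|sv] := boolP (is_sink (ori M) v); last by exists v.
have [/existsP[i nzi]|] := boolP [exists i, U (nb v i) != 0].
  by exists (nb v i); rewrite ?is_sink_nb ?sv.
rewrite negb_exists => /forallP z0; have {}z0 i : U (nb v i) = 0 by apply/eqP; rewrite -[_ == _]negbK z0.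
have [C eC] := sur sv.
have w1 : (1%:M <= W v)%MS.
  rewrite -eC; apply: summx_sub => i _; apply: (submx_trans _ (sw (nb v i) v _)); last first.
    by rewrite /arrow adj_sym adj_nb sv.
  apply: submxMr; apply: submx_trans (submx1 _) _.
  by have := uw1 (nb v i); rewrite z0 adds0mx.
case/negP: nz; rewrite -submx0 -(eqP (uw v)) sub_capmx submx_refl /=.
exact: submx_trans (submx1 _) w1.
Qed.

(** A decomposition of M would induce one of N. The alternative [dm N v = 0] in the hypothesis on
    kernels allows N to be sigma M truncated at some sinks, as happens when boundary vertices are
    deleted. *)
Lemma indecomposable_kernel : indecomposable N -> indecomposable M.
Proof.
move=> [[v nzv] ind]; split.
  have [sv|sv] := boolP (is_sink (ori M) v); last first.
    by exists v; rewrite -(inv_dm (gh sv).1 (gh sv).2).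
  have [e|[_ inj _]] := ker sv; first by rewrite e in nzv.
  have [/existsP[i nzi]|] := boolP [exists i, 0 < dm M (nb v i)]%N; first by exists (nb v i).
  rewrite negb_exists => /forallP z0; suff e : dm N v = 0%N by rewrite e in nzv.
  apply/scalar_mx1_eq0/inj => i.
  have e : dm N (nb v i) = 0%N.
    have s : ~~ is_sink (ori M) (nb v i) by rewrite is_sink_nb sv.
    by rewrite (inv_dm (gh s).1 (gh s).2); apply/eqP; rewrite -leqn0 leqNgt z0.
  by move: (_ *m _); rewrite e => A; apply: thinmx0.
move=> [U [W [uw [arr [nU nW]]]]]; apply: ind.
have uw0 v' : (U v' :&: W v')%MS == 0 by have /andP[] := uw v'.
have wu0 v' : (W v' :&: U v')%MS == 0 by rewrite capmxC.
have uw1 v' : (1%:M <= U v' + W v')%MS by have /andP[] := uw v'.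
have wu1 v' : (1%:M <= W v' + U v')%MS by rewrite addsmxC.
have su a b (ab : arrow (ori M) a b) : (U a *m mp M a b <= U b)%MS by have [] := arr a b ab.
have sw a b (ab : arrow (ori M) a b) : (W a *m mp M a b <= W b)%MS by have [] := arr a b ab.
exists (trans U), (trans W); split; [|split].
- by move=> v'; rewrite trans_cap // andbT; apply: trans_add.
- by move=> a b ab; split; apply: trans_arrow.
split; first exact: (trans_neq0 uw0 uw1 sw).
exact: (trans_neq0 wu0 wu1 su).
Qed.

End Transport.

(** M is a shift of sigma^- M, and each sink space of sigma^- M, being a cokernel, is covered by its
    neighbours; so [indecomposable_kernel] applies to the pair. *)
Lemma indecomposable_sigmam M :
  (forall v, ~~ is_sink (ori M) v -> forall p (W : 'M[k]_(p, dm M v)),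
     (forall i, W *m mp M v (nb v i) = 0) -> W = 0) ->
  indecomposable M -> indecomposable (sigmam M).
Proof.
move=> inj; have sm := sigmam_spec M.
have [eo [g [h gh]]] := sigmam_sigma sm inj.
apply: (indecomposable_kernel (g := g) (h := h)) => //.
- by move=> v sv; have [/(_ sv)] := gh v.
- by move=> v sv; right; have [_ /(_ sv)] := gh v.
move=> v; rewrite is_sinkN => sv.
have [_ [g' [h' gh']]] := sm; have [_ /(_ sv)[_ _ sj]] := gh' v.
have [U eU] := sj _ 1%:M; exists (fun i => U i *m g' (nb v i)); by rewrite -eU.
Qed.

End Indec.

(** * Representations supported on a ball *)

Section BallRep.
Variables (k : fieldType) (n : nat) (o : bool) (c : Vtx n) (rho d e : nat).
Variable F : Vtx n -> Vtx n -> nat -> k.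

Definition ball_dm (v : Vtx n) : nat :=
  if (dist c v < rho)%N then d else if dist c v == rho then e else 0%N.

(** Identity between inner vertices, and the column of coefficients [F a b] on an arrow to the
    sphere. In the uses below either e = 0 or the sphere consists of sinks, so no arrow leading
    inwards from the sphere carries a nonzero map. *)
Definition ball_mp (a b : Vtx n) : 'M[k]_(ball_dm a, ball_dm b) :=
  if (dist c b < rho)%N then pid_mx d else \matrix_(i, j) F a b i.

Definition ball_rep : rep k n := @Rep k n o ball_dm ball_mp.

Lemma ball_dm_in v : (dist c v < rho)%N -> ball_dm v = d.
Proof. by rewrite /ball_dm => ->. Qed.

Lemma ball_dm_bd v : dist c v = rho -> ball_dm v = e.
Proof. by rewrite /ball_dm => ->; rewrite ltnn eqxx. Qed.

Lemma ball_dm_out v : (rho < dist c v)%N -> ball_dm v = 0%N.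
Proof. by rewrite /ball_dm => h; rewrite ltnNge (ltnW h) gtn_eqF. Qed.

Lemma pid_unit p q : p = d -> q = d -> row_free (pid_mx d : 'M[k]_(p, q)) /\ row_full (pid_mx d : 'M[k]_(p, q)).
Proof. by move=> -> ->; rewrite pid_mx_1 row_free_unit row_full_unit unitmx1. Qed.

Lemma ball_mp_in a b : (dist c a < rho)%N -> (dist c b < rho)%N ->
  row_free (ball_mp a b) /\ row_full (ball_mp a b).
Proof. by move=> ha hb; rewrite /ball_mp hb; apply: pid_unit; apply: ball_dm_in. Qed.

Lemma sub_complement p q p' q' m (A : 'M[k]_(p, m)) (B : 'M[k]_(q, m)) (A' : 'M[k]_(p', m)) (B' : 'M[k]_(q', m)) :
  (1%:M <= A + B)%MS -> (A' :&: B')%MS = 0 -> (A <= A')%MS -> (B <= B')%MS -> (A' <= A)%MS.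
Proof.
move=> h1 h0 sA sB.
have : (A' <= (A + B) :&: A')%MS by rewrite sub_capmx submx_refl andbT; apply: submx_trans (submx1 _) h1.
rewrite -(matrix_modl _ sA) => /submx_trans; apply.
rewrite addsmx_sub submx_refl /=; apply: (@submx_trans _ _ _ _ _ _ (A' :&: B')%MS); last by rewrite h0 sub0mx.
by rewrite capmxC capmxS.
Qed.

Section Indecomposable.
Hypothesis d_gt0 : (0 < d)%N.
Hypothesis rho_gt0 : (0 < rho)%N.
Hypothesis e_le1 : (e <= 1)%N.
Hypothesis bd_sink : (0 < e)%N -> forall v, dist c v = rho -> is_sink o v.
Hypothesis bd_full : forall a b, adj a b -> (dist c a < rho)%N -> dist c b = rho ->
  row_full (ball_mp a b).
(** The linear algebra left to each use: a splitting of the common fibre in which every boundary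
    functional kills one of the summands must be trivial. *)
Hypothesis compat : forall U W : 'M[k]_d, (1%:M <= U + W)%MS -> (U :&: W)%MS = 0 ->
  (forall a b, (0 < e)%N -> adj a b -> (dist c a < rho)%N -> dist c b = rho ->
     U *m (\col_i F a b i) = 0 \/ W *m (\col_i F a b i) = 0) -> U = 0 \/ W = 0.

Let P v : 'M[k]_(ball_dm v, d) := pid_mx d.
Let Q v : 'M[k]_(d, ball_dm v) := pid_mx d.

Let PQ v : (dist c v < rho)%N -> P v *m Q v = 1%:M.
Proof.
move=> h; rewrite /P /Q; move: (ball_dm_in h) => ->.
by rewrite pid_mx_1 mulmx1.
Qed.

Let QP v : (dist c v < rho)%N -> Q v *m P v = 1%:M.
Proof.
move=> h; rewrite /P /Q; move: (ball_dm_in h) => ->.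
by rewrite pid_mx_1 mulmx1.
Qed.

Section OneSided.
Variables U W : forall v, 'M[k]_(ball_dm v).
Hypothesis UW0 : forall v, (U v :&: W v)%MS = 0.
Hypothesis UW1 : forall v, (1%:M <= U v + W v)%MS.
Hypothesis Uarr : forall a b, arrow o a b -> (U a *m ball_mp a b <= U b)%MS.
Hypothesis Warr : forall a b, arrow o a b -> (W a *m ball_mp a b <= W b)%MS.

Lemma ball_fib1 v : (dist c v < rho)%N -> (1%:M <= U v *m P v + W v *m P v)%MS.
Proof.
move=> h; rewrite -addsmxMr -(QP h); apply: submxMr.
exact: submx_trans (submx1 _) (UW1 _).
Qed.

Lemma ball_fib0 v : (dist c v < rho)%N -> (U v *m P v :&: W v *m P v)%MS = 0.
Proof.
move=> h; set X := (_ :&: _)%MS; rewrite -[X]mulmx1 -(QP h) mulmxA.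
have : (X *m Q v <= U v :&: W v)%MS.
  rewrite sub_capmx; apply/andP; split.
    rewrite -[U v]mulmx1 -(PQ h) mulmxA; exact/submxMr/capmxSl.
  rewrite -[W v]mulmx1 -(PQ h) mulmxA; exact/submxMr/capmxSr.
by rewrite UW0 submx0 => /eqP ->; rewrite mul0mx.
Qed.

Lemma ball_mpP a b : (dist c a < rho)%N -> (dist c b < rho)%N -> ball_mp a b *m P b = P a.
Proof.
move=> ha hb; rewrite /ball_mp hb /P mul_pid_mx minnn.
by rewrite (_ : minn (ball_dm b) d = d) //; rewrite ball_dm_in // minnn.
Qed.

Lemma ball_arr (V : forall v, 'M[k]_(ball_dm v)) a b :
  (forall a b, arrow o a b -> (V a *m ball_mp a b <= V b)%MS) -> arrow o a b ->
  (dist c a < rho)%N -> (dist c b < rho)%N -> (V a *m P a <= V b *m P b)%MS.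
Proof.
move=> Varr ab ha hb; rewrite -(ball_mpP ha hb) mulmxA; exact/submxMr/Varr.
Qed.

(** Inner maps are identities, so an arrow gives one inclusion between fibres of U, and the same for
    W. As U and W are complementary at both ends, both inclusions are equalities ([sub_complement]);
    connectedness of the ball does the rest. *)
Lemma ball_const v : (dist c v < rho)%N -> (U v *m P v <= U c *m P c)%MS /\ (U c *m P c <= U v *m P v)%MS.
Proof.
move: v; suff H m v : dist c v = m -> (m < rho)%N ->
    (U v *m P v <= U c *m P c)%MS /\ (U c *m P c <= U v *m P v)%MS.
  by move=> v; apply: H.
elim: m v => [|m ih] v ev hm.
  by move/eqP: ev; rewrite dist_eq0 => /eqP ->.
have [i ei] : exists i, (dist c (nb v i)).+1 = dist c v by apply: dist_down_nb; rewrite ev.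
have hv : (dist c v < rho)%N by rewrite ev.
have hu : (dist c (nb v i) < rho)%N by lia.
have [||h1 h2] := ih (nb v i); try lia.
suff [s1 s2] : (U v *m P v <= U (nb v i) *m P (nb v i))%MS /\
               (U (nb v i) *m P (nb v i) <= U v *m P v)%MS.
  by split; [apply: submx_trans h1 | apply: submx_trans h2 _].
have [sv|sv] := boolP (is_sink o v).
  have ar : arrow o (nb v i) v by rewrite /arrow adj_sym adj_nb sv.
  have := ball_arr Uarr ar hu hv; have := ball_arr Warr ar hu hv => w u.
  by split=> //; apply: (sub_complement (ball_fib1 hu) (ball_fib0 hv) u w).
have ar : arrow o v (nb v i) by rewrite /arrow adj_nb is_sink_nb.
have := ball_arr Uarr ar hv hu; have := ball_arr Warr ar hv hu => w u.
by split=> //; apply: (sub_complement (ball_fib1 hv) (ball_fib0 hu) u w).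
Qed.

(** Inside the ball U is constant. At a boundary vertex the full inner fibre belongs to W and maps
    onto the space there, so W is everything and U is zero. *)
Lemma ball_zero : U c *m P c = 0 -> forall v, U v = 0.
Proof.
move=> U0.
have Uin v : (dist c v < rho)%N -> U v = 0.
  move=> h; have [s _] := ball_const h; rewrite U0 in s; have e0 := submx0null s.
  by rewrite -[U v]mulmx1 -(PQ h) mulmxA e0 mul0mx.
move=> v; have [h|h|h] := ltngtP (dist c v) rho; first exact: Uin.
  by move: (U v); rewrite ball_dm_out // => A; apply: thinmx0.
have [i ei] : exists i, (dist c (nb v i)).+1 = dist c v by apply: dist_down_nb; rewrite h.
have hu : (dist c (nb v i) < rho)%N by lia.
have [e0|e0] := posnP e.
  by move: (U v); rewrite ball_dm_bd // e0 => A; apply: thinmx0.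
have ar : arrow o (nb v i) v by rewrite /arrow adj_sym adj_nb bd_sink.
have /row_fullP[B eB] : row_full (ball_mp (nb v i) v) by apply: bd_full; rewrite // adj_sym adj_nb.
have : (1%:M <= W v)%MS.
  rewrite -eB; apply: (submx_trans _ (Warr ar)); apply: submxMr.
  apply: submx_trans (submx1 _) _.
  by have := UW1 (nb v i); rewrite Uin // adds0mx.
move=> w1; apply/eqP; rewrite -submx0 -(UW0 v) sub_capmx submx_refl /=.
exact: submx_trans (submx1 _) w1.
Qed.

Lemma ball_bd a b : arrow o a b -> (dist c a < rho)%N -> dist c b = rho -> (0 < e)%N ->
  U b = 0 -> U c *m P c *m (\col_i F a b i) = 0.
Proof.
move=> ab ha hb e0 U0; have [_ s] := ball_const ha.
have := Uarr ab; rewrite U0 submx0 => /eqP m0.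
suff m0' : U a *m P a *m (\col_i F a b i) = 0.
  by have /submxP[D ->] := s; rewrite -mulmxA m0' mulmx0.
have hb0 : (0 < ball_dm b)%N by rewrite ball_dm_bd.
have ea := ball_dm_in ha.
apply/matrixP => x y; have /matrixP/(_ x (Ordinal hb0)) := m0.
rewrite -mulmxA !mxE => m1; rewrite -[RHS]m1; apply: eq_bigr => i _; congr (_ * _).
rewrite /ball_mp hb ltnn !mxE.
have hi : (i < d)%N by rewrite -ea.
rewrite (bigD1 (Ordinal hi)) //= !mxE /= eqxx hi mul1r big1 ?addr0 // => j ne.
rewrite !mxE; case: eqP => [eij|]; last by rewrite mul0r.
by case/eqP: ne; apply: val_inj.
Qed.
End OneSided.

Lemma ball_rep_indecomposable : indecomposable ball_rep.
Proof.
split; first by exists c; rewrite /= ball_dm_in // dist_self.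
move=> [U [W [uw [arr [[u nU] [w nW]]]]]].
have uw0 v : (U v :&: W v)%MS = 0 by have /andP[_ /eqP] := uw v.
have wu0 v : (W v :&: U v)%MS = 0 by rewrite capmxC.
have uw1 v : (1%:M <= U v + W v)%MS by have /andP[] := uw v.
have wu1 v : (1%:M <= W v + U v)%MS by rewrite addsmxC.
have su a b (ab : arrow o a b) : (U a *m ball_mp a b <= U b)%MS by have [] := arr a b ab.
have sw a b (ab : arrow o a b) : (W a *m ball_mp a b <= W b)%MS by have [] := arr a b ab.
have hc : (dist c c < rho)%N by rewrite dist_self.
(* [compat] speaks of square matrices, so the common fibres are replaced by their square
   generators. *)
have [||a b e0 ab ha hb|U0|W0] := @compat <<U c *m P c>>%MS <<W c *m P c>>%MS.
- by rewrite (adds_eqmx (genmxE _) (genmxE _)); apply: ball_fib1.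
- apply/eqP; rewrite -submx0 (cap_eqmx (genmxE _) (genmxE _)).
  by rewrite ball_fib0.
- have ar : arrow o a b by rewrite /arrow ab bd_sink.
  suff [z|z] : U b = 0 \/ W b = 0.
  + left; apply/eqP; rewrite -submx0 (eqmxMr _ (genmxE _)).
    by rewrite (ball_bd uw0 uw1 su sw ar ha hb e0 z) sub0mx.
  + right; apply/eqP; rewrite -submx0 (eqmxMr _ (genmxE _)).
    by rewrite (ball_bd wu0 wu1 sw su ar ha hb e0 z) sub0mx.
  (* The boundary space has dimension at most one, so one of the two summands vanishes there. *)
  have : (\rank (U b) + \rank (W b) <= 1)%N.
    have := mxrank_sum_cap (U b) (W b); rewrite uw0 mxrank0 addn0 => <-.
    by apply: leq_trans (rank_leq_col _) _; rewrite /= ball_dm_bd.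
  have [/eqP|h1] := posnP (\rank (U b)); first by rewrite mxrank_eq0 => /eqP; left.
  have [/eqP|h2] := posnP (\rank (W b)); first by rewrite mxrank_eq0 => /eqP; right.
  lia.
- case/negP: nU; apply/eqP; apply: (ball_zero uw0 uw1 su sw).
  by apply: (@submx0null _ _ d d); rewrite -(genmxE (U c *m P c)) U0.
case/negP: nW; apply/eqP; apply: (ball_zero wu0 wu1 sw su).
by apply: (@submx0null _ _ d d); rewrite -(genmxE (W c *m P c)) W0.
Qed.

End Indecomposable.
End BallRep.

(** * Growth of supports along lines *)

Section Lines.
Variables (k : fieldType) (n : nat).
Implicit Types (M N : rep k n) (v a c : Vtx n) (L : int -> Vtx n).

Definition is_line L :=
  (forall t, adj (L t) (L (t + 1))) /\ (forall t, L t != L (t + 2)).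

Definition consec (s t : int) := s = t + 1 \/ t = s + 1.

Lemma line_adj L s t : is_line L -> consec s t -> adj (L s) (L t).
Proof. by move=> [ha _] [->|->]; rewrite // adj_sym. Qed.

Lemma line_ne L s t : is_line L -> consec s t -> L s != L (t + t - s).
Proof.
move=> [_ hn] [e|e].
  by have := hn (t + t - s); rewrite eq_sym (_ : t + t - s + 2 = s) //; lia.
by rewrite (_ : t + t - s = s + 2) //; lia.
Qed.

Lemma line_sink L o s t : is_line L -> consec s t -> is_sink o (L t) = ~~ is_sink o (L s).
Proof. by move=> hL /(line_adj hL); apply: is_sink_adj. Qed.

Lemma line_dist L s (m : nat) : is_line L -> dist (L s) (L (s + m%:Z)) = m.
Proof.
move=> [ha hn]; have := @ray_dist n (fun j => L (s + j%:Z)).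
rewrite addr0; apply=> j; first by rewrite -[j.+1]addn1 PoszD addrA.
by rewrite -[j.+2]addn2 PoszD addrA.
Qed.

Lemma line_dist0 L t : is_line L -> dist (L 0) (L t) = `|t|%N.
Proof.
move=> hL; have [m [e|e]] : exists m : nat, t = m%:Z \/ t = - m%:Z by exists `|t|%N; lia.
  by have := line_dist 0 m hL; rewrite add0r e absz_nat.
by have := line_dist t m hL; rewrite e addNr dist_sym abszN absz_nat.
Qed.

Definition lineE M L := forall s t, consec s t -> ~~ is_sink (ori M) (L s) ->
  row_free (mp M (L s) (L t)).

Definition lineD M L := forall s t, consec s t -> is_sink (ori M) (L t) ->
  row_full (mp M (L s) (L t)).

(** The new map from L s to L t is injective because the old map from L t to its other neighbour on
    the line, at position [t + t - s], is. *)
Lemma lineE_sigmam M L : is_line L -> lineE M L -> lineE (sigmam M) L.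
Proof.
move=> hL E s t st; rewrite /= is_sinkN negbK => ss.
have stt : ~~ is_sink (ori M) (L t) by rewrite (line_sink _ hL st) ss.
have st' : consec t (t + t - s) by move: st; rewrite /consec; lia.
apply: sigmam_row_free (line_ne hL st) _ => //; [|exact: line_adj st'|exact: E].
by rewrite adj_sym; apply: line_adj st.
Qed.

Lemma lineD_sigma M L : is_line L -> lineD M L -> lineD (sigma M) L.
Proof.
move=> hL D s t st; rewrite /= is_sinkN => stt.
have ss : is_sink (ori M) (L s) by rewrite -[is_sink _ _]negbK -(line_sink _ hL st).
have st' : consec (s + s - t) s by move: st; rewrite /consec; lia.
have ne : L t != L (s + s - t) by apply: line_ne => //; move: st; rewrite /consec; lia.
by apply: sigma_row_full ne _ => //; [exact: line_adj st|rewrite adj_sym; exact: line_adj st'|apply: D].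
Qed.

Lemma lineE_iter M L j : is_line L -> lineE (sigmam M) L -> lineE (iter j.+1 (@sigmam k n) M) L.
Proof. by move=> hL E; elim: j => //= j; apply: lineE_sigmam. Qed.

Lemma lineD_iter M L j : is_line L -> lineD (sigma M) L -> lineD (iter j.+1 (@sigma k n) M) L.
Proof. by move=> hL E; elim: j => //= j; apply: lineD_sigma. Qed.

Lemma inner_nb (t : int) (R : nat) : (`|t| <= R.+1)%N -> (0 < R)%N ->
  exists2 s, consec s t & (`|s| <= R)%N.
Proof.
by move=> ht hR; have [h|h] := lerP t 0; [exists (t + 1) | exists (t - 1)];
  rewrite /consec; lia.
Qed.

(** The positions with |t| = R + j + 1 are sources at step j, so they are reflected next and receive
    an injective map from a nonzero neighbour. Injectivity is assumed from sigma^- M on, since in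
    the case b = 0 the maps of M onto the sphere are not injective. *)
Lemma line_grow_sigmam M L (R : nat) : is_line L -> (0 < R)%N -> lineE (sigmam M) L ->
  (forall t, `|t|%N = R.+1 -> ~~ is_sink (ori M) (L t)) ->
  (forall t, (`|t| <= R)%N -> 0 < dm M (L t))%N ->
  forall j t, (`|t| <= R + j)%N -> (0 < dm (iter j (@sigmam k n) M) (L t))%N.
Proof.
move=> hL hR E par nz j.
suff [] : (forall t, `|t|%N = (R + j).+1 -> ~~ is_sink (ori (iter j (@sigmam k n) M)) (L t)) /\
  (forall t, (`|t| <= R + j)%N -> (0 < dm (iter j (@sigmam k n) M) (L t))%N) by [].
elim: j => [|j [parj nzj]]; first by rewrite addn0.
have EJ := @lineE_iter M L j hL E.
rewrite iterS; set N := iter j _ M in parj nzj *; split => t ht.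
  have [s st hs] : exists2 s, consec s t & `|s|%N = (R + j).+1.
    by have [h|h] := lerP t 0; [exists (t + 1) | exists (t - 1)]; rewrite /consec; lia.
  by rewrite /= is_sinkN negbK (line_sink _ hL st) parj.
have [st|st] := boolP (is_sink (ori N) (L t)).
  rewrite /= sigmam_dm_sink //; apply: nzj; rewrite leqNgt; apply/negP => h.
  have e : `|t|%N = (R + j).+1 by lia.
  by have := parj t e; rewrite st.
have [||s cs hs] := @inner_nb t (R + j)%N; try lia.
have ss : is_sink (ori N) (L s) by move: st; rewrite (line_sink _ hL cs) negbK.
apply: (@row_free_pos _ _ _ (mp (sigmam N) (L s) (L t))); last first.
  by rewrite /= sigmam_dm_sink //; apply: nzj.
by apply: EJ => //=; rewrite is_sinkN negbK.
Qed.

Lemma line_grow_sigma M L (R : nat) : is_line L -> (0 < R)%N -> lineD (sigma M) L ->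
  (forall t, `|t|%N = R.+1 -> is_sink (ori M) (L t)) ->
  (forall t, (`|t| <= R)%N -> 0 < dm M (L t))%N ->
  forall j t, (`|t| <= R + j)%N -> (0 < dm (iter j (@sigma k n) M) (L t))%N.
Proof.
move=> hL hR D par nz j.
suff [] : (forall t, `|t|%N = (R + j).+1 -> is_sink (ori (iter j (@sigma k n) M)) (L t)) /\
  (forall t, (`|t| <= R + j)%N -> (0 < dm (iter j (@sigma k n) M) (L t))%N) by [].
elim: j => [|j [parj nzj]]; first by rewrite addn0.
have DJ := @lineD_iter M L j hL D.
rewrite iterS; set N := iter j _ M in parj nzj *; split => t ht.
  have [s st hs] : exists2 s, consec s t & `|s|%N = (R + j).+1.
    by have [h|h] := lerP t 0; [exists (t + 1) | exists (t - 1)]; rewrite /consec; lia.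
  by rewrite /= is_sinkN (line_sink _ hL st) parj.
have [st|st] := boolP (is_sink (ori N) (L t)); last first.
  rewrite /= sigma_dm_source //; apply: nzj; rewrite leqNgt; apply/negP => h.
  by case/negP: st; apply: parj; lia.
have [||s cs hs] := @inner_nb t (R + j)%N; try lia.
have ss : ~~ is_sink (ori N) (L s) by rewrite -(line_sink _ hL cs).
apply: (@row_full_pos _ _ _ (mp (sigma N) (L t) (L s))); last first.
  by rewrite /= sigma_dm_source //; apply: nzj.
apply: DJ => //=; last by rewrite is_sinkN.
by move: cs; rewrite /consec; lia.
Qed.

(** * Supports, diameters and centers along a shift orbit *)

Lemma ball_grow_sigma M c R : (forall v, 0 < dm M v -> dist c v <= R)%N ->
  forall j v, (0 < dm (iter j (@sigma k n) M) v -> dist c v <= R + j)%N.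
Proof.
move=> h; elim=> [|j ih] v; first by rewrite addn0; apply: h.
rewrite iterS => nz; set N := iter j _ M in ih nz.
have [sv|sv] := boolP (is_sink (ori N) v).
  by have [i /ih] := sigma_supp sv nz; have := dist_adj c (adj_nb v i); lia.
by move: nz; rewrite /= sigma_dm_source // => /ih; lia.
Qed.

Lemma ball_grow_sigmam M c R : (forall v, 0 < dm M v -> dist c v <= R)%N ->
  forall j v, (0 < dm (iter j (@sigmam k n) M) v -> dist c v <= R + j)%N.
Proof.
move=> h; elim=> [|j ih] v; first by rewrite addn0; apply: h.
rewrite iterS => nz; set N := iter j _ M in ih nz.
have [sv|sv] := boolP (is_sink (ori N) v); last first.
  by have [i /ih] := sigmam_supp sv nz; have := dist_adj c (adj_nb v i); lia.
by move: nz; rewrite /= sigmam_dm_sink // => /ih; lia.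
Qed.

Lemma supp_path_fun N (p : nat -> Vtx n) m : (forall j, (j < m)%N -> adj (p j) (p j.+1)) ->
  (forall j, (j.+1 < m)%N -> p j != p j.+2) -> (forall j, (j <= m)%N -> 0 < dm N (p j))%N ->
  exists x s, supp_path N x s /\ size s = m.
Proof.
move=> ha hn hd; exists (p 0%N), [seq p j | j <- iota 1 m]; rewrite size_map size_iota.
split=> //; split; first exact: tpath_fun.
rewrite /= hd //=; apply/allP => v /mapP[j]; rewrite mem_iota => hj ->.
by apply: hd; lia.
Qed.

Lemma supp_path_line N L (R : nat) : is_line L ->
  (forall t, (`|t| <= R)%N -> 0 < dm N (L t))%N ->
  exists x s, supp_path N x s /\ size s = R.*2.
Proof.
move=> hL nz; apply: (@supp_path_fun N (fun j => L (j%:Z - R%:Z))).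
- by move=> j _; apply: line_adj => //; rewrite /consec; lia.
- move=> j _; have [_ /(_ (j%:Z - R%:Z))] := hL.
  by rewrite (_ : j.+2%:Z - R%:Z = j%:Z - R%:Z + 2) //; lia.
by move=> j hj; apply: nz; lia.
Qed.

Lemma diam_uniq N d d' : diam N d -> diam N d' -> d = d'.
Proof.
move=> [[x [s [p <-]]] h] [[x' [s' [p' <-]]] h'].
by apply/eqP; rewrite eqn_leq (h' _ _ p) (h _ _ p').
Qed.

Lemma diam_ball N c R : (forall v, 0 < dm N v -> dist c v <= R)%N ->
  (exists x s, supp_path N x s /\ size s = R.*2) ->
  diam N R.*2 /\ forall x s, diam_path N x s ->
    [/\ nth x (x :: s) R = c, dist c x = R & dist c (last x s) = R].
Proof.
move=> hb ex.
have bp x s : supp_path N x s -> all (fun v => dist c v <= R)%N (x :: s).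
  by move=> [_ /allP h]; apply/allP => v /h; apply: hb.
have dN : diam N R.*2.
  by split=> // x s sp; have [] := tpath_ball sp.1 (bp _ _ sp).
split=> // x s [sp dp]; have [_] := tpath_ball sp.1 (bp _ _ sp); apply.
exact: diam_uniq dp dN.
Qed.

Lemma diam_edge N a a' R : adj a a' -> (forall v, 0 < dm N v -> dist a v + dist a' v <= R.*2.+1)%N ->
  (exists x s, supp_path N x s /\ size s = R.*2.+1) ->
  diam N R.*2.+1 /\ center_edge N a a'.
Proof.
move=> aa hb ex.
have bp x s : supp_path N x s -> all (fun v => dist a v + dist a' v <= R.*2.+1)%N (x :: s).
  by move=> [_ /allP h]; apply/allP => v /h; apply: hb.
have dN : diam N R.*2.+1.
  by split=> // x s sp; have [] := tpath_edge aa sp.1 (bp _ _ sp).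
split=> //; exists R.*2.+1; split=> //; split; first by rewrite /= odd_double.
move=> x s [sp dp]; have [_] := tpath_edge aa sp.1 (bp _ _ sp).
by rewrite (diam_uniq dp dN) /= uphalf_double; apply.
Qed.

Lemma ori_iter_sigma M j : ori (iter j (@sigma k n) M) = ori M (+) odd j.
Proof. by elim: j => [|j /= ->]; rewrite ?addbF // addbN. Qed.

Lemma ori_iter_sigmam M j : ori (iter j (@sigmam k n) M) = ori M (+) odd j.
Proof. by elim: j => [|j /= ->]; rewrite ?addbF // addbN. Qed.

(** The six support hypotheses give diameter 2(r + j) and center x for sigma^-j M, diameter 2r - 1
    and center edge {a_(i-1), a_i} for 1 <= i <= b, and diameter 2(r + j) and center a_b for
    sigma^(b+1+j) M. Minimality of the radius holds because the modules of odd diameter are not sink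
    modules and all the others have radius at least r. *)
Lemma shift_orbit_criterion M (x : Vtx n) (s : seq (Vtx n)) (r : nat) :
  (0 < r)%N -> is_tpath x s -> is_sink (ori M) x = ~~ odd r ->
  (forall j v, 0 < dm (iter j (@sigmam k n) M) v -> dist x v <= r + j)%N ->
  (forall j, exists p q, supp_path (iter j (@sigmam k n) M) p q /\ size q = (r + j).*2) ->
  (forall i v, (1 <= i <= size s)%N -> (0 < dm (iter i (@sigma k n) M) v)%N ->
     (dist (nth x (x :: s) i.-1) v + dist (nth x (x :: s) i) v <= r.*2.-1)%N) ->
  (forall i, (1 <= i <= size s)%N ->
     exists p q, supp_path (iter i (@sigma k n) M) p q /\ size q = r.*2.-1) ->
  (forall j v, 0 < dm (iter ((size s).+1 + j) (@sigma k n) M) v -> dist (last x s) v <= r + j)%N ->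
  (forall j, exists p q, supp_path (iter ((size s).+1 + j) (@sigma k n) M) p q /\ size q = (r + j).*2) ->
  regular M /\ is_M0 M /\ radius M r /\ center_path M x s.
Proof.
move=> hr hs sx bA pA bB pB bC pC.
have A j := diam_ball (bA j) (pA j).
have C j := diam_ball (bC j) (pC j).
have B i : (1 <= i <= size s)%N -> diam (iter i (@sigma k n) M) r.*2.-1 /\
   center_edge (iter i (@sigma k n) M) (nth x (x :: s) i.-1) (nth x (x :: s) i).
  move=> hi; have er : r.*2.-1 = r.-1.*2.+1 by lia.
  rewrite er; apply: diam_edge; last 2 first.
  - by move=> v; rewrite -er; apply: bB.
  - by rewrite -er; apply: pB.
  have /andP[/(pathP x) h _] := hs.
  by case: i hi => // i hi; apply: h.
have nzp N m : (exists p q, supp_path N p q /\ size q = m) -> nonzero_rep N.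
  by move=> [p [q [[_ /= /andP[h _]] _]]]; exists p.
have [dM hM] := A 0%N; rewrite addn0 /= in dM hM.
have rM r1 : radius M r1 -> r1 = r.
  by move=> [d [dd <-]]; rewrite (diam_uniq dd dM) doubleK.
have odd_end N c R p q : (forall p q, diam_path N p q ->
    [/\ nth p (p :: q) R = c, dist c p = R & dist c (last p q) = R]) -> diam_path N p q ->
    vodd p = vodd c (+) odd R /\ vodd (last p q) = vodd c (+) odd R.
  by move=> h /h[_ e1 e2]; rewrite (vodd_dist c p) (vodd_dist c (last p q)) e1 e2.
split; [|split; [|split]].
- move=> [m|m] /=; last exact: nzp (pA m.+1).
  have [e|h] := posnP m; first by rewrite e; apply: nzp (pA 0%N).
  have [h'|h'] := leqP m (size s); first by apply: (nzp _ r.*2.-1); apply: pB; lia.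
  by rewrite (_ : m = ((size s).+1 + (m - (size s).+1))%N); [apply: nzp (pC _)|lia].
- split.
    move=> p q /(odd_end _ _ _ _ _ hM)[e1 e2].
    by rewrite !is_sinkE e1 e2; move: sx; rewrite is_sinkE; case: (vodd x); case: (ori M); case: (odd r).
  move=> t r1 r2 st /rM -> {r1} [d [dd <-]].
  case: t st dd => [m|m] /= st dd.
    have [e|h] := posnP m; first by move: dd; rewrite e /= => /diam_uniq/(_ dM) ->; rewrite doubleK.
    have [h'|h'] := leqP m (size s).
      have [|dm1 _] := B m; first by lia.
      have [[p [q [sp sq]]] _] := dm1.
      have /st[] : diam_path (iter m (@sigma k n) M) p q by split=> //; rewrite sq.
      (* A path of odd length joins vertices of opposite parity, so its ends cannot both be
         sinks. *)
      have : vodd (last p q) = vodd p (+) odd (size q).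
        have [/andP[pp _] _] := sp; elim: q p pp {sp sq} => [|u q ih] p /=; first by rewrite addbF.
        by move=> /andP[/vodd_adj e /ih ->]; rewrite e; case: (vodd p); case: (odd _).
      rewrite !is_sinkE sq => ->.
      have -> : odd r.*2.-1 by rewrite -(prednK hr) doubleS /= odd_double.
      by case: (vodd p); case: (ori _).
    move: dd; rewrite (_ : m = ((size s).+1 + (m - (size s).+1))%N); last by lia.
    by move=> /diam_uniq/(_ (C _).1) ->; rewrite doubleK leq_addr.
  by move: dd => /diam_uniq/(_ (A m.+1).1) ->; rewrite doubleK leq_addr.
- by exists r.*2; rewrite doubleK.
split; [|split].
- exists r.*2; rewrite odd_double doubleK; split=> //; split=> // p q /hM[] //.
- move=> i hi; have [d e] := B i hi; split=> //.
  exists r.*2.-1; split=> //; by rewrite -(prednK hr) doubleS /= odd_double.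
move=> p q; have [dC hC] := C 0%N; rewrite !addn0 in dC hC.
rewrite /shift => /(odd_end _ _ _ _ _ hC)[e1 e2].
rewrite !is_sinkE e1 e2 ori_iter_sigma.
(* The ends of a diameter path lie at distance r from a_b, which is b steps from x, and the
   orientation has been reversed b + 1 times; together this makes them sources. *)
have -> : vodd (last x s) = vodd x (+) odd (size s).
  have /andP[pp _] := hs; elim: (s) (x) pp => [|u q' ih] x' /=; first by rewrite addbF.
  by move=> /andP[/vodd_adj e /ih ->]; rewrite e; case: (vodd x'); case: (odd _).
move: sx; rewrite is_sinkE /=.
by case: (vodd x); case: (ori M); case: (odd r); case: (odd (size s)).
Qed.

End Lines.

(** * Center paths of length zero *)

Section Rays.
Variable n : nat.
Implicit Types (c : Vtx n).

Lemma ray_last c (i j : 'I_n) m :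
  ray c i j m.+1 = nb (ray c i j m) (if odd m then j else i).
Proof. by elim: m c i j => // m ih c i j; rewrite -[LHS]/(ray (nb c i) j i m.+1) ih /= if_neg. Qed.

Lemma dist_ray c (i j : 'I_n) m : i != j -> dist c (ray c i j m) = m.
Proof. by move=> ne; apply: (@ray_dist _ (ray c i j)) => l; [apply: ray_adj|apply: ray_ne]. Qed.

Lemma Negz_add1 (m : nat) : Negz m.+1 + 1 = Negz m.
Proof. by lia. Qed.

(** Two rays glued at c, starting with the letters i and j. [Negz m] stands for -(m + 1), which
    explains the successor. *)
Definition line_of c (i j : 'I_n) (t : int) : Vtx n :=
  match t with Posz m => ray c i j m | Negz m => ray c j i m.+1 end.

Lemma is_line_of c (i j : 'I_n) : i != j -> is_line (line_of c i j).
Proof.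
move=> ne; split.
  case=> [m|[|m]]; first by rewrite -PoszD addn1; apply: ray_adj.
    by rewrite /= adj_sym adj_nb.
  rewrite Negz_add1.
  by rewrite adj_sym; apply: ray_adj.
case=> [m|[|[|m]]]; first by rewrite -PoszD addn2; apply: ray_ne.
- by rewrite /=; apply: contraNneq ne => /(@nb_inj n) ->.
- by rewrite /= -{2}[c](nbK c j); apply: contraNneq ne => /(@nb_inj n) ->.
rewrite (_ : Negz m.+2 + 2 = Negz m); last by lia.
by rewrite eq_sym; apply: ray_ne; rewrite eq_sym.
Qed.

End Rays.

Section BallMaps.
Variables (k : fieldType) (n : nat) (o : bool) (c : Vtx n) (rho d : nat).
Variable F : Vtx n -> Vtx n -> nat -> k.
Let dmB := ball_dm c rho d 1.

Lemma ball_pid v : (dist c v < rho)%N ->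
  (pid_mx d : 'M[k]_(dmB v, d)) *m (pid_mx d : 'M[k]_(d, dmB v)) = 1%:M /\
  (pid_mx d : 'M[k]_(d, dmB v)) *m (pid_mx d : 'M[k]_(dmB v, d)) = 1%:M.
Proof. by move=> h; rewrite /dmB ball_dm_in // pid_mx_1 mulmx1. Qed.

Lemma ball_mp_bd a b : (dist c a < rho)%N -> dist c b = rho ->
  ball_mp c rho d 1 F a b =
  (pid_mx d : 'M[k]_(dmB a, d)) *m (\col_(i < d) F a b i) *m (pid_mx 1 : 'M[k]_(1, dmB b)).
Proof.
move=> ha hb; rewrite /ball_mp hb ltnn /dmB (ball_dm_in _ _ ha) (ball_dm_bd _ _ hb).
by rewrite !pid_mx_1 mul1mx mulmx1; apply/matrixP => x y; rewrite !mxE.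
Qed.

Lemma ball_mp_bd_eq0 a b p (w : 'M[k]_(p, dmB a)) : (dist c a < rho)%N -> dist c b = rho ->
  w *m ball_mp c rho d 1 F a b = 0 <-> w *m pid_mx d *m (\col_(i < d) F a b i) = 0.
Proof.
move=> ha hb; rewrite ball_mp_bd // !mulmxA; split=> [e|->]; last by rewrite mul0mx.
have := congr1 (mulmx^~ (pid_mx 1 : 'M[k]_(dmB b, 1))) e.
by rewrite /= mul0mx -mulmxA /dmB (ball_dm_bd _ _ hb) pid_mx_1 mulmx1 mulmx1.
Qed.

End BallMaps.

Section CaseZero.
Variables (k : fieldType) (n : nat) (hn : (3 <= n)%N).

(* the functional on k^2 attached to an edge with letter l: its kernel is one *)
(* of three pairwise distinct lines                                           *)
Definition letter_coef (l i : nat) : k :=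
  match l with 0 => (i == 0%N)%:R | 1 => (i == 1%N)%:R | _ => 1 end.

Definition edge_letter (a b : Vtx n) : nat :=
  if [pick i | nb a i == b] is Some i then val i else 0%N.

Lemma edge_letterE a i : edge_letter a (nb a i) = i.
Proof.
rewrite /edge_letter; case: pickP => [j|/(_ i)]; last by rewrite eqxx.
by rewrite (inj_eq (@nb_inj n a)) => /eqP ->.
Qed.

Definition edge_coef a b := letter_coef (edge_letter a b).

Definition letter_col l : 'cV[k]_2 := \col_i letter_coef l i.

Definition letter_ker l : 'rV[k]_2 :=
  match l with
  | 0 => \row_j (j == 1%N :> nat)%:R
  | 1 => \row_j (j == 0%N :> nat)%:R
  | _ => \row_j (if j == 0%N :> nat then 1 else -1)
  end.

(** Pairs of letters whose functionals have different kernels. All letters from 2 on share one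
    functional, so 0, 1 and 2 represent the three kernels. *)
Definition letter_pair (i j : nat) := [\/ (i = 0 /\ j = 1), (i = 0 /\ j = 2) | (i = 1 /\ j = 2)]%N.

Lemma letter_ker_col l : letter_ker l *m letter_col l = 0.
Proof.
apply/matrixP => a b; rewrite !mxE !big_ord_recl big_ord0 /letter_ker /letter_col.
by case: l => [|[|l]]; rewrite !mxE /=; ring.
Qed.

Lemma letter_col_eq0 p (w : 'M[k]_(p, 2)) i j : letter_pair i j ->
  w *m letter_col i = 0 -> w *m letter_col j = 0 -> w = 0.
Proof.
move=> ij /matrixP hi /matrixP hj; apply/matrixP => a b.
have := hi a 0; have := hj a 0; rewrite !mxE !big_ord_recl !big_ord0 !mxE => {hi hj}.
have [->|->] : b = ord0 \/ b = lift ord0 ord0.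
- by case: b => -[|[|//]] hb; [left|right]; apply: val_inj.
- set u := w a ord0; set v := w a _; case: ij => -[-> ->] /= e1 e2.
  + by rewrite -[RHS]e2; ring.
  + by rewrite -[RHS]e2; ring.
  by transitivity ((u * 1 + (v * 1 + 0)) - (u * 0 + (v * 1 + 0))); [ring|rewrite e1 e2 subr0].
set u := w a ord0; set v := w a _; case: ij => -[-> ->] /= e1 e2.
- by rewrite -[RHS]e1; ring.
- by transitivity ((u * 1 + (v * 1 + 0)) - (u * 1 + (v * 0 + 0))); [ring|rewrite e1 e2 subr0].
by rewrite -[RHS]e2; ring.
Qed.

Lemma letter_ker_span i j : letter_pair i j ->
  exists A B : 'cV[k]_2, A *m letter_ker i + B *m letter_ker j = 1%:M.
Proof.
case=> -[-> ->].
- exists (\col_l (l == 1%N :> nat)%:R), (\col_l (l == 0%N :> nat)%:R).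
  apply/matrixP => a b; rewrite !mxE !big_ord1 !mxE.
  by case: a b => -[|[|//]] ? [[|[|//]] ?]; rewrite /=; ring.
- exists (\col_l 1), (\col_l (l == 0%N :> nat)%:R).
  apply/matrixP => a b; rewrite !mxE !big_ord1 !mxE.
  by case: a b => -[|[|//]] ? [[|[|//]] ?]; rewrite /=; ring.
exists (\col_l 1), (\col_l (if l == 1%N :> nat then -1 else 0)).
apply/matrixP => a b; rewrite !mxE !big_ord1 !mxE.
by case: a b => -[|[|//]] ? [[|[|//]] ?]; rewrite /=; ring.
Qed.

Lemma letters : exists l0 l1 l2 : 'I_n, [/\ val l0 = 0, val l1 = 1 & val l2 = 2]%N.
Proof.
have h0 : (0 < n)%N by lia. have h1 : (1 < n)%N by lia.
by exists (Ordinal h0), (Ordinal h1), (Ordinal hn).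
Qed.

(** Here n >= 3 enters: after excluding one neighbour, two functionals with different kernels
    remain. *)
Lemma other_letters (i : 'I_n) : exists j1 j2 : 'I_n, [/\ j1 != i, j2 != i & letter_pair j1 j2].
Proof.
have [l0 [l1 [l2 [e0 e1 e2]]]] := letters.
have ne (a b : 'I_n) : val a <> val b -> a != b by move=> h; apply/eqP => e; case: h; rewrite e.
case: (eqVneq (val i) 0%N) => [i0|i0].
  by exists l1, l2; split; [apply: ne; lia|apply: ne; lia|constructor 3].
case: (eqVneq (val i) 1%N) => [i1|i1].
  by exists l0, l2; split; [apply: ne; lia|apply: ne; lia|constructor 2].
by exists l0, l1; split; [apply: ne; lia|apply: ne; lia|constructor 1].
Qed.

Variables (Omega : bool) (x : Vtx n) (r : nat).
Hypothesis hr : (0 < r)%N.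
Hypothesis hsink : is_sink Omega x = ~~ odd r.

Definition star_rep : rep k n := ball_rep Omega x r 2 1 edge_coef.

Lemma sink_parity v : is_sink Omega v = (odd (dist x v) == odd r).
Proof.
move: hsink; rewrite !is_sinkE (vodd_dist x v).
by case: (vodd x); case: Omega; case: (odd r); case: (odd _).
Qed.

Lemma edge_colE a i : \col_(j < 2) edge_coef a (nb a i) j = letter_col i.
Proof. by apply/matrixP => u v; rewrite !mxE /edge_coef edge_letterE. Qed.

(** Each of the three functionals occurs at the boundary and kills U or W. Two of them kill the same
    summand, which lies in the intersection of two distinct lines and is zero. *)
Lemma star_indecomposable : indecomposable star_rep.
Proof.
apply: ball_rep_indecomposable => //.
- by move=> _ v ev; rewrite sink_parity ev eqxx.
- move=> a b /adjP[i ->] ha hb.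
  rewrite ball_mp_bd // edge_colE /ball_dm ha hb ltnn eqxx !pid_mx_1 mul1mx mulmx1.
  have nz : letter_col i != 0.
    apply/eqP => /matrixP e; case: (val i) e => [|[|l]] e.
    - by have := e 0 0; rewrite !mxE /=; apply/eqP/oner_neq0.
    - by have := e (lift 0 0) 0; rewrite !mxE /=; apply/eqP/oner_neq0.
    by have := e 0 0; rewrite !mxE /=; apply/eqP/oner_neq0.
  rewrite /row_full eqn_leq rank_leq_col /= lt0n mxrank_eq0 //.
move=> U W _ _ h.
have hl (l l' : 'I_n) : l != l' -> U *m letter_col l = 0 \/ W *m letter_col l = 0.
  move=> ne; case: r hr h => // m _ h.
  (* An inner vertex at distance r - 1 whose edge with letter l leads outwards: the end of an
     alternating ray, with the starting letter chosen by parity so that l comes next. *)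
  have [b [eb db da]] : exists a, [/\ dist x a = m, dist x (nb a l) = m.+1 & True].
    have ne' : l' != l by rewrite eq_sym.
    have [om|om] := boolP (odd m).
      exists (ray x l' l m); rewrite dist_ray //; split=> //.
      by have := ray_last x l' l m; rewrite om => <-; rewrite dist_ray.
    exists (ray x l l' m); rewrite dist_ray //; split=> //.
    by have := ray_last x l l' m; rewrite (negPf om) => <-; rewrite dist_ray.
  have := h b (nb b l) isT (adj_nb b l).
  by rewrite eb db edge_colE; apply.
have [l0 [l1 [l2 [e0 e1 e2]]]] := letters.
have ne (a b : 'I_n) : val a <> val b -> a != b by move=> h'; apply/eqP => e; case: h'; rewrite e.
have p01 : letter_pair l0 l1 by constructor 1.
have p02 : letter_pair l0 l2 by constructor 2.
have p12 : letter_pair l1 l2 by constructor 3.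
have [||] := hl l0 l1; first (by apply: ne; lia); move=> h0.
  have [||] := hl l1 l0; first (by apply: ne; lia); move=> h1.
    by left; apply: (letter_col_eq0 p01).
  have [||] := hl l2 l0; first (by apply: ne; lia); move=> h2.
    by left; apply: (letter_col_eq0 p02).
  by right; apply: (letter_col_eq0 p12).
have [||] := hl l1 l0; first (by apply: ne; lia); move=> h1; last first.
  by right; apply: (letter_col_eq0 p01).
have [||] := hl l2 l0; first (by apply: ne; lia); move=> h2.
  by left; apply: (letter_col_eq0 p12).
by right; apply: (letter_col_eq0 p02).
Qed.

Let M := star_rep.

(** If another neighbour is inside the ball, the map to it is the identity. Otherwise all other
    neighbours are on the sphere, and two functionals with different kernels are jointly injective
    on k^2. *)
Lemma star_jinj v i : ~~ is_sink Omega v -> jinj M v i.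
Proof.
move=> sv; have [h|h|h] := ltngtP (dist x v) r.
- have [/existsP[j /andP[ji hj]]|] := boolP [exists j, (j != i) && (dist x (nb v j) < r)%N].
    by apply: (@row_free_jinj _ _ M v i j); [rewrite eq_sym|apply: (ball_mp_in 2 1 edge_coef h hj).1].
  rewrite negb_exists => /forallP nj p w hw.
  have [j1 [j2 [n1 n2 p12]]] := other_letters i.
  have bd j : j != i -> dist x (nb v j) = r.
    move=> ji; have := nj j; rewrite ji /= -leqNgt.
    by have := dist_adj x (adj_nb v j); lia.
  have wP : w *m (pid_mx 2 : 'M[k]_(_, 2)) = 0.
    apply: (letter_col_eq0 p12).
      by have := hw _ n1; move/ball_mp_bd_eq0 => /(_ h (bd _ n1)); rewrite edge_colE.
    by have := hw _ n2; move/ball_mp_bd_eq0 => /(_ h (bd _ n2)); rewrite edge_colE.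
  by rewrite -[w]mulmx1 -(ball_pid k 2 h).1 mulmxA wP mul0mx.
- by move=> p w _; move: w; rewrite /= ball_dm_out // => w; apply: thinmx0.
by move: sv; rewrite sink_parity h eqxx.
Qed.

Lemma star_dm v : (dist x v <= r)%N -> (0 < dm M v)%N.
Proof.
rewrite leq_eqVlt => /orP[/eqP h|h]; first by rewrite /= ball_dm_bd.
by rewrite /= ball_dm_in.
Qed.

Lemma star_dm0 v : (0 < dm M v)%N -> (dist x v <= r)%N.
Proof. by move=> nz; rewrite leqNgt; apply/negP => h; move: nz; rewrite /= ball_dm_out. Qed.

(** Sinks have the parity of r, so the vertices at distance r + 1 are sources and stay zero: the
    first shift does not enlarge the ball. *)
Lemma star_sigma_supp v : (0 < dm (sigma M) v)%N -> (dist x v <= r)%N.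
Proof.
have [sv|sv] := boolP (is_sink (ori M) v); last first.
  by rewrite /= sigma_dm_source //; apply: star_dm0.
move=> /(sigma_supp sv)[i /star_dm0 h].
have := dist_adj x (adj_nb v i); move: sv; rewrite sink_parity => /eqP hp [e|e]; try lia.
Qed.

Lemma two_letters (i : 'I_n) : exists j : 'I_n, j != i.
Proof. by have [j [_ [h _ _]]] := other_letters i; exists j. Qed.

Lemma star_inner_full a j : ~~ is_sink Omega a -> (dist x a < r)%N -> (dist x (nb a j) < r)%N ->
  row_full (mp (sigma M) (nb a j) a).
Proof.
move=> sa ha hj; have [l lj] := two_letters j.
have sj : is_sink Omega (nb a j) by rewrite is_sink_nb.
apply: (@sigma_row_full _ _ M (nb a j) a (nb (nb a j) l)) => //.
- by rewrite adj_sym adj_nb.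
- exact: adj_nb.
- by rewrite -{1}[a](nbK a j); apply: contraNneq lj => /(@nb_inj n) ->.
apply: (ball_mp_in 2 1 edge_coef _ hj).2.
have : ~~ is_sink Omega (nb (nb a j) l) by rewrite is_sink_nb sj.
rewrite sink_parity => hp; have := dist_adj x (adj_nb (nb a j) l).
have : dist x (nb (nb a j) l) <> r by move=> e; rewrite e eqxx in hp.
lia.
Qed.

(** Next to the sphere, a boundary neighbour of a carries in sigma M the kernel of its functional,
    and two different kernels span k^2. Elsewhere a single inner map is already surjective. *)
Lemma star_jsurj a i : is_sink (ori (sigma M)) a -> jsurj (sigma M) a i.
Proof.
rewrite /= is_sinkN => sa.
have [_ [g [h gh]]] := sigma_spec M.
have [/(_ sa)[g1 h1] _] := gh a.
have [ha|ha|ha] := ltngtP (dist x a) r; last 2 first.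
- exists (fun=> 0) => //; rewrite big1 => [|j _]; last by rewrite mul0mx.
  have e : dm (sigma M) a = 0%N by rewrite (inv_dm g1 h1) /= ball_dm_out.
  by move: (1%:M : 'M[k]_(dm (sigma M) a)); rewrite e => A; rewrite thinmx0.
- by move: sa; rewrite sink_parity ha eqxx.
have [/existsP[j /andP[ji hj]]|] := boolP [exists j, (j != i) && (dist x (nb a j) < r)%N].
  by apply: (row_full_jsurj (j := j)); [rewrite eq_sym|apply: star_inner_full].
rewrite negb_exists => /forallP nj.
have bd j : j != i -> dist x (nb a j) = r.
  move=> ji; have := nj j; rewrite ji /= -leqNgt.
  by have := dist_adj x (adj_nb a j); lia.
have ker j : j != i -> exists W : 'rV[k]_(dm (sigma M) (nb a j)),
    W *m mp (sigma M) (nb a j) a *m g a = letter_ker j *m (pid_mx 2 : 'M[k]_(2, dm M a)).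
  move=> ji; have sj : is_sink (ori M) (nb a j) by rewrite is_sink_nb.
  have [_ /(_ sj)[_ _ ex]] := gh (nb a j).
  have [d [dj dn]] := @single_family k n 1 (fun l => dm M (nb (nb a j) l)) j
     (letter_ker j *m pid_mx 2).
  have [|W eW] := ex _ d; last by exists W; have := eW j; rewrite dj nbK.
  rewrite (sum_single (i := j)) => [|l /dn ->]; last by rewrite mul0mx.
  rewrite dj nbK; apply/ball_mp_bd_eq0 => //; first exact: bd.
  by rewrite edge_colE -(mulmxA (letter_ker j)) (ball_pid k 2 ha).2 mulmx1 letter_ker_col.
have [j1 [j2 [n1 n2 p12]]] := other_letters i.
have [W1 e1] := ker _ n1; have [W2 e2] := ker _ n2.
have [A [B eAB]] := letter_ker_span p12.
have [d1 [d1j d1n]] := @single_family k n (dm (sigma M) a) (fun l => dm (sigma M) (nb a l)) j1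
   (g a *m pid_mx 2 *m A *m W1).
have [d2 [d2j d2n]] := @single_family k n (dm (sigma M) a) (fun l => dm (sigma M) (nb a l)) j2
   (g a *m pid_mx 2 *m B *m W2).
exists (fun l => d1 l + d2 l); first by rewrite d1n 1?eq_sym // d2n 1?eq_sym // addr0.
under eq_bigr do rewrite mulmxDl.
rewrite big_split /= (sum_single (i := j1)) => [|l /d1n ->]; last by rewrite mul0mx.
rewrite (sum_single (i := j2)) => [|l /d2n ->]; last by rewrite mul0mx.
rewrite d1j d2j -[LHS]mulmx1 -g1 mulmxA mulmxDl -!(mulmxA _ W1) -!(mulmxA _ W2).
rewrite -!(mulmxA _ _ (g a)) !(mulmxA W1) !(mulmxA W2) e1 e2 !mulmxA -mulmxDl.
rewrite -!(mulmxA _ A) -!(mulmxA _ B) -mulmxDr eAB mulmx1.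
by rewrite -(mulmxA (g a)) (ball_pid k 2 ha).1 mulmx1.
Qed.

(** A boundary vertex survives because a functional on k^2 has a nonzero kernel, and an inner sink
    because it maps onto a nonzero source. *)
Lemma star_sigma_dm v : (dist x v <= r)%N -> (0 < dm (sigma M) v)%N.
Proof.
move=> hv; have [sv|sv] := boolP (is_sink (ori M) v); last first.
  by rewrite /= sigma_dm_source //; apply: star_dm.
have [j1 _] := letters; have [a [j [av ha ev]]] : exists a j,
    [/\ v = nb a j, (dist x a < r)%N & ~~ is_sink Omega a].
  have [v0|/dist_down_nb[i ei]] := posnP (dist x v).
    exists (nb v j1), j1; rewrite nbK is_sink_nb negbK; split=> //.
    (* The vertex x is a sink only for even r, so r >= 2 and each of its neighbours is inside the
       ball. *)
    have := sink_parity v; rewrite sv v0 => /esym/eqP /= hp.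
    have := dist_adj x (adj_nb v j1); rewrite v0; case: (r) hr hp => [|[|m]] //=; lia.
  by exists (nb v i), i; rewrite nbK is_sink_nb negbK; split=> //; lia.
move: hv; rewrite leq_eqVlt => /orP[/eqP hv|hv]; last first.
  apply: (row_full_pos (A := mp (sigma M) v a)).
    by rewrite av; apply: star_inner_full => //; rewrite -av.
  by rewrite /= sigma_dm_source //; apply: star_dm; lia.
have [_ [g [h gh]]] := sigma_spec M.
have [_ /(_ sv)[_ _ ex]] := gh v.
have [d [dj dn]] := @single_family k n 1 (fun l => dm M (nb v l)) j
  (letter_ker j *m pid_mx 2).
have ea : a = nb v j by rewrite av nbK.
have [|W eW] := ex _ d.
  rewrite (sum_single (i := j)) => [|l /dn ->]; last by rewrite mul0mx.
  rewrite dj -ea; apply/ball_mp_bd_eq0 => //.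
  by rewrite av edge_colE -(mulmxA (letter_ker j)) (ball_pid k 2 ha).2 mulmx1 letter_ker_col.
rewrite lt0n; apply/negP => /eqP z0.
have W0 : W = 0 by move: W {eW}; rewrite z0 => W; apply: thinmx0.
have := eW j; rewrite W0 !mul0mx dj -ea => /esym e0.
have := congr1 (mulmx^~ (pid_mx 2 : 'M[k]_(dm M a, 2))) e0.
rewrite /= mul0mx -mulmxA (ball_pid k 2 ha).2 mulmx1 => /matrixP e.
have := e 0 0; have := e 0 (lift 0 0); rewrite /letter_ker.
by case: (val j) => [|[|l]]; rewrite !mxE /= => e1 e2; case/eqP: (oner_neq0 k); first [exact: e1|exact: e2].
Qed.

Lemma star_case : fin_supp M /\ indecomposable M /\ regular M /\
  is_M0 M /\ radius M r /\ center_path M x [::].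
Proof.
split; first by exists (ball_seq x r) => v /star_dm0; apply: mem_ball.
split; first exact: star_indecomposable.
have [l0 [l1 [_ [e0 e1 _]]]] := letters.
have ne : l0 != l1 by apply/eqP => e; move: e0; rewrite e e1.
have hL := is_line_of x ne; set L := line_of x l0 l1 in hL.
have dL t : dist x (L t) = `|t|%N by have := line_dist0 t hL.
have nz t : (`|t| <= r)%N -> (0 < dm M (L t))%N by move=> h; apply: star_dm; rewrite dL.
have nz1 t : (`|t| <= r)%N -> (0 < dm (sigma M) (L t))%N by move=> h; apply: star_sigma_dm; rewrite dL.
have par t : `|t|%N = r.+1 -> ~~ is_sink Omega (L t).
  by move=> e; rewrite sink_parity dL e /=; case: (odd r).
have E : lineE (sigmam M) L.
  move=> s t st; rewrite /= is_sinkN negbK => ss.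
  have /adjP[i ->] : adj (L t) (L s) by rewrite adj_sym; apply: line_adj st.
  have stt : ~~ is_sink Omega (L t) by rewrite (line_sink _ hL st) ss.
  exact/(jinj_sigmam (sigmam_spec M) stt)/star_jinj.
have D : lineD (sigma (sigma M)) L.
  move=> s t st; rewrite /= is_sinkN => stt.
  have /adjP[i ->] : adj (L s) (L t) by apply: line_adj st.
  have ss : is_sink (ori (sigma M)) (L s) by rewrite -[is_sink _ _]negbK -(line_sink _ hL st).
  exact/(jsurj_sigma (sigma_spec (sigma M)) ss)/star_jsurj.
apply: (@shift_orbit_criterion k n M x [::] r) => //.
- exact: (ball_grow_sigmam star_dm0).
- by move=> j; apply: (supp_path_line hL); apply: (line_grow_sigmam hL hr E).
- by case.
- by case.
- by move=> j v; rewrite -[(_ + j)%N]/(j.+1) iterSr; apply: (ball_grow_sigma star_sigma_supp).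
move=> j; apply: (supp_path_line hL) => t ht; rewrite -[(_ + j)%N]/(j.+1) iterSr.
apply: (line_grow_sigma hL hr D _ nz1) => // t' /par.
by rewrite /= is_sinkN.
Qed.

End CaseZero.

(** * Center paths of positive length *)

Lemma row_full_dim0 (k : fieldType) p q (A : 'M[k]_(p, q)) : q = 0%N -> row_full A.
Proof. by move=> e; move: A; rewrite e => A; rewrite thinmx0 /row_full mxrank0. Qed.

Lemma row_free_dim0 (k : fieldType) p q (A : 'M[k]_(p, q)) : p = 0%N -> row_free A.
Proof. by move=> e; move: A; rewrite e => A; rewrite flatmx0 /row_free mxrank0. Qed.

(** * Deleting vertices from a representation *)

Section Delete.
Variables (k : fieldType) (n : nat) (N : rep k n) (D : pred (Vtx n)).

Definition del_dm v : nat := if D v then 0%N else dm N v.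

Definition del_rep : rep k n :=
  @Rep k n (ori N) del_dm (fun a b => conform_mx 0 (mp N a b)).

Lemma del_rep_iso : iso_on (fun v => ~~ D v) del_rep N.
Proof.
split=> //; exists (fun v => pid_mx (del_dm v)), (fun v => pid_mx (dm N v)).
have e v : ~~ D v -> del_dm v = dm N v by rewrite /del_dm => /negPf ->.
split=> [v /e ev|a b _ /e ea /e eb].
  by rewrite (pid_mx_castK k ev) (pid_mx_castK k (esym ev)).
by rewrite /= (conform_mxE (mp N a b) ea eb) -!mulmxA (pid_mx_castK k (esym eb)) mulmx1.
Qed.

(** The deleted vertices are sinks at which the shift Y of N is zero, so Y is a truncation of the
    shift of [del_rep], and [indecomposable_kernel] applies with its alternative [dm N v = 0]. *)
Lemma del_rep_indecomposable Y : is_sigma N Y ->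
  (forall v, D v -> is_sink (ori N) v /\ dm Y v = 0%N) ->
  (forall v, is_sink (ori N) v -> exists U : forall i, 'M[k]_(dm N v, dm N (nb v i)),
     \sum_i U i *m mp N (nb v i) v = 1%:M) ->
  indecomposable Y -> indecomposable del_rep.
Proof.
move=> [oY [g [h gh]]] hD sur.
have [_ [f [f' [ff fc]]]] := del_rep_iso.
have nD v : ~~ is_sink (ori N) v -> ~~ D v by apply: contra => /hD[].
have fc' a b : arrow (ori N) a b -> ~~ D a -> ~~ D b ->
    f' a *m mp del_rep a b = mp N a b *m f' b.
  move=> ab da db; have [f1 f2] := ff _ da; have [f1' f2'] := ff _ db.
  by rewrite -[LHS]mulmx1 -f1' !mulmxA -(mulmxA (f' a)) -fc // !mulmxA f2 mul1mx.
have ar v i : is_sink (ori N) v -> arrow (ori N) (nb v i) v by move=> sv; rewrite /arrow adj_sym adj_nb sv.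
have dn v i : is_sink (ori N) v -> ~~ D (nb v i) by move=> sv; apply: nD; rewrite is_sink_nb sv.
apply: (@indecomposable_kernel k n del_rep Y (fun v => g v *m f' v) (fun v => f v *m h v)) => //=.
- move=> v sv; have [/(_ sv)[g1 h1] _] := gh v; have [f1 f2] := ff v (nD _ sv).
  split; first by rewrite !mulmxA -(mulmxA (g v)) f2 mulmx1.
  by rewrite !mulmxA -(mulmxA (f v)) h1 mulmx1.
- move=> v sv; have [/hD[_ ->]|dv] := boolP (D v); first by left.
  right; have [_ /(_ sv)[z inj ex]] := gh v; split=> [|//|p U U0].
  + transitivity ((\sum_(i < n) mp Y v (nb v i) *m g (nb v i) *m mp N (nb v i) v) *m f' v).
      rewrite mulmx_suml; apply: eq_bigr => i _.
      by rewrite -!mulmxA fc' //; [exact: ar|exact: dn].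
    by rewrite z mul0mx.
  have [|W eW] := ex p (fun i => U i *m f (nb v i)).
    transitivity ((\sum_(i < n) U i *m mp del_rep (nb v i) v) *m f v); last by rewrite U0 mul0mx.
    rewrite mulmx_suml; apply: eq_bigr => i _.
    by rewrite -!mulmxA fc //; [exact: ar|exact: dn].
  exists W => i; rewrite mulmxA eW -mulmxA.
  by have [-> _] := ff _ (dn v i sv); rewrite mulmx1.
move=> v sv; have [dv|dv] := boolP (D v).
  exists (fun=> 0); have e : del_dm v = 0%N by rewrite /del_dm dv.
  by move: (\sum_i _) (1%:M); rewrite /= e => A B; rewrite !thinmx0.
have [U eU] := sur v sv.
exists (fun i => f v *m U i *m f' (nb v i)).
transitivity (f v *m (\sum_i U i *m mp N (nb v i) v) *m f' v).
  rewrite mulmx_sumr mulmx_suml; apply: eq_bigr => i _.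
  by rewrite -!mulmxA fc' //; [exact: ar|exact: dn].
by rewrite eU mulmx1; have [] := ff _ dv.
Qed.

End Delete.

(** * Inverse shifts of the thin ball *)

Section Inflate.
Variables (k : fieldType) (n : nat) (hn : (3 <= n)%N) (o : bool) (x : Vtx n) (rho : nat).
Hypothesis hsink : is_sink o x = ~~ odd rho.

(** With e = 0 the sphere of radius rho + 1 carries zero, so this is k on the closed ball of radius
    rho. *)
Definition thin_ball : rep k n := ball_rep o x rho.+1 1 0 (fun _ _ _ => 0).

Definition infl j : rep k n := iter j (@sigmam k n) thin_ball.

Lemma thin_ball_indecomposable : indecomposable thin_ball.
Proof.
apply: ball_rep_indecomposable => //.
  by move=> a b _ _ hb; apply/row_full_dim0/ball_dm_bd.
move=> U W _ h0 _.
have := mxrank_sum_cap U W; rewrite h0 mxrank0 addn0 => e.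
have := rank_leq_col (U + W)%MS; rewrite e => h.
have [/eqP|h1] := posnP (\rank U); first by rewrite mxrank_eq0 => /eqP; left.
have [/eqP|h2] := posnP (\rank W); first by rewrite mxrank_eq0 => /eqP; right.
by have := leq_add h1 h2; move=> h'; have := leq_trans h' h.
Qed.

Lemma infl_sink j v : is_sink (ori (infl j)) v = (odd (dist x v) == odd (rho + j)).
Proof.
rewrite /infl ori_iter_sigmam /= oddD; move: hsink; rewrite !is_sinkE (vodd_dist x v).
by case: (vodd x); case: (o); case: (odd rho); case: (odd (dist _ _)); case: (odd j).
Qed.

Lemma another_nb (v u : Vtx n) : exists i, nb v i != u.
Proof.
have h0 : (0 < n)%N by lia. have h1 : (1 < n)%N by lia.
have [e|ne] := eqVneq (nb v (Ordinal h0)) u; last by exists (Ordinal h0).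
exists (Ordinal h1); rewrite -e; apply/eqP => /(@nb_inj n).
by move/(congr1 val).
Qed.

(** In the thin ball the sphere consists of sinks, so every nonzero source maps identically to all
    its neighbours; each sigma^- then preserves injectivity by [sigmam_row_free]. *)
Lemma infl_row_free j v u : arrow (ori (infl j)) v u -> row_free (mp (infl j) v u).
Proof.
elim: j v u => [|j ih] v u.
  move=> vu; have /arrowP[i eu sv] := vu.
  have [h|h] := ltnP (dist x v) rho.+1; last first.
    by apply: row_free_dim0; rewrite /= /ball_dm ltnNge h; case: ifP.
  have ne : dist x v != rho by apply: contraNneq sv => e; rewrite (infl_sink 0) e addn0.
  apply: (ball_mp_in 1 0 _ h _).1.
  by rewrite eu; have := dist_adj x (adj_nb v i); lia.
move=> /andP[a]; rewrite /= is_sinkN => sv.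
have [i ne] := another_nb v u.
have [i' ne'] := another_nb u v.
apply: (sigmam_row_free (u' := nb u i')) => //.
- by rewrite adj_sym.
- exact: adj_nb.
- by rewrite eq_sym.
by apply: ih; rewrite /arrow adj_nb is_sink_nb.
Qed.

Lemma infl_inj j v : ~~ is_sink (ori (infl j)) v -> forall p (W : 'M[k]_(p, dm (infl j) v)),
  (forall i, W *m mp (infl j) v (nb v i) = 0) -> W = 0.
Proof.
move=> sv p W h; have [i _] := another_nb v v.
apply/eqP; rewrite -(mulmx_free_eq0 _ (@infl_row_free j v (nb v i) _)) ?h //.
by rewrite /arrow adj_nb is_sink_nb.
Qed.

Lemma infl_is_sigma j : is_sigma (infl j.+1) (infl j).
Proof. exact: (sigmam_sigma (sigmam_spec (infl j)) (@infl_inj j)). Qed.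

Lemma infl_indecomposable j : indecomposable (infl j).
Proof.
elim: j => [|j ih]; first exact: thin_ball_indecomposable.
exact: indecomposable_sigmam (@infl_inj j) ih.
Qed.

Lemma infl_dm_le j v : (0 < dm (infl j) v)%N -> (dist x v <= rho + j)%N.
Proof.
apply: ball_grow_sigmam => {}v; rewrite /= /ball_dm.
by have [h|h] := ltnP (dist x v) rho.+1; [lia|case: ifP].
Qed.

Lemma infl_dm j v : (dist x v <= rho + j)%N -> (0 < dm (infl j) v)%N.
Proof.
elim: j v => [|j ih] v; first by rewrite addn0 => h; rewrite /= ball_dm_in.
move=> hv; have := infl_sink j v.
have [sv /esym/eqP hp|sv /esym/eqP hp] := boolP (is_sink (ori (infl j)) v).
  by rewrite /= sigmam_dm_sink //; apply: ih; lia.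
have [i hi] : exists i, (dist x (nb v i) <= rho + j)%N.
  have [v0|/dist_down_nb[i ei]] := posnP (dist x v); last by exists i; lia.
  have [i _] := another_nb v v; exists i.
  by have := dist_adj x (adj_nb v i); lia.
apply: (row_free_pos (A := mp (infl j.+1) (nb v i) v)); last first.
  by rewrite /= sigmam_dm_sink ?is_sink_nb //; apply: ih.
apply: infl_row_free; rewrite /arrow adj_sym adj_nb.
by rewrite /= is_sinkN.
Qed.

(** For j > 0 the leaf is a cokernel at a vertex with a single neighbour in the previous support,
    hence a quotient of that one space. *)
Lemma infl_leaf_full j u a : arrow (ori (infl j)) u a -> dist x a = (rho + j)%N ->
  dist x a = (dist x u).+1 -> row_full (mp (infl j) u a).
Proof.
case: j => [|j] ua ea eu; first by apply: (ball_mp_in 1 0 _ _ _).2; lia.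
have sa : ~~ is_sink (ori (infl j)) a.
  by rewrite -is_sinkN; have /andP[] := ua.
have [_ [g [h gh]]] := sigmam_spec (infl j).
have [_ /(_ sa)[_ _ sj]] := gh a.
have /adjP[i eui] : adj a u by rewrite adj_sym; have /andP[] := ua.
have [U eU] := sj _ 1%:M.
apply/row_fullP; rewrite eui; exists (U i *m g (nb a i)); rewrite [RHS]eU.
rewrite (sum_single (i := i)) // => l li.
suff -> : U l = 0 by rewrite !mul0mx.
have e0 : dm (infl j) (nb a l) = 0%N.
  apply/eqP; rewrite -leqn0 leqNgt; apply/negP => /infl_dm_le hl.
  have := dist_adj x (adj_nb a l) => -[e|e]; first by lia.
  case/negP: li; apply/eqP/(@nb_inj n a); rewrite -eui.
  by apply: (@dist_down_uniq n x a); rewrite ?adj_nb // eui adj_nb.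
by move: (U l); rewrite e0 => A; apply: thinmx0.
Qed.

Lemma infl_sink_surj j v : is_sink (ori (infl j.+1)) v ->
  exists U : forall i, 'M[k]_(dm (infl j.+1) v, dm (infl j.+1) (nb v i)),
     \sum_i U i *m mp (infl j.+1) (nb v i) v = 1%:M.
Proof.
rewrite /= is_sinkN => sv; have [_ [g [h gh]]] := sigmam_spec (infl j).
have [_ /(_ sv)[_ _ sj]] := gh v; have [U eU] := sj _ 1%:M.
by exists (fun i => U i *m g (nb v i)); rewrite -eU.
Qed.

End Inflate.

(** * The module with a center path of length b > 0 *)

Section CaseFlow.
Variables (k : fieldType) (n : nat) (hn : (3 <= n)%N) (Omega : bool).
Variables (x : Vtx n) (s : seq (Vtx n)) (r : nat).
Hypothesis hpath : is_tpath x s.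
Hypothesis hr : (0 < r)%N.
Hypothesis hb : (0 < size s)%N.
Hypothesis hbr : (size s <= r)%N.
Hypothesis hsink : is_sink Omega x = ~~ odd r.

Let b := size s.
Let y := last x s.
Let rho := (r - b)%N.
(** Each sigma^- reverses the orientation, so the starting orientation is chosen to make [P b] a
    representation of Omega, supported on the ball of radius r. *)
Let P := infl k (Omega (+) odd b) x rho.

Lemma flow_sink : is_sink (Omega (+) odd b) x = ~~ odd rho.
Proof.
move: hsink; rewrite !is_sinkE /rho oddB //.
by case: (vodd x); case: Omega; case: (odd r); case: (odd b).
Qed.
Let hP := flow_sink.

(** Since y is at distance b from x and b + rho = r, these are the vertices of the sphere of radius
    r whose geodesic from x passes through y. *)
Definition cut (z : Vtx n) : bool := (dist x z == r) && (dist y z == rho).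

Definition flow_rep : rep k n := del_rep (P b) cut.

Let M i := iter i (@sigma k n) flow_rep.

Lemma flow_ori i : ori (M i) = Omega (+) odd i.
Proof.
rewrite /M ori_iter_sigma /= ori_iter_sigmam /=.
by case: Omega; case: (odd b); case: (odd i).
Qed.

Lemma flow_sinkE i v : is_sink (ori (M i)) v = (odd (dist x v) == odd (r + i)).
Proof.
rewrite flow_ori oddD; move: hsink; rewrite !is_sinkE (vodd_dist x v).
by case: (vodd x); case: Omega; case: (odd r); case: (odd (dist _ _)); case: (odd i).
Qed.

Lemma rho_b : (rho + b = r)%N. Proof. by rewrite /rho subnK. Qed.

Lemma cut_sink z : cut z -> is_sink (ori (P b)) z.
Proof. by move=> /andP[/eqP e _]; rewrite (infl_sink k hP) e rho_b. Qed.

(** The set on which the deletion is not yet felt after i shifts. The maximum with 1 records that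
    the first shift loses nothing: for i = 0 and i = 1 only the deleted vertices are excluded. *)
Definition far i (v : Vtx n) : Prop := forall z, cut z -> (maxn i 1 <= dist z v)%N.

Lemma far_in i v : (0 < i)%N -> (dist x v + i <= r)%N -> far i v.
Proof.
move=> hi hv z /andP[/eqP e _]; have := dist_triangle x v z.
by rewrite e (dist_sym v z); lia.
Qed.

(** By locality of sigma the influence of the deletion spreads by at most one edge per shift, and
    [P (b - i)] is the corresponding shift of [P b]. *)
Lemma flow_iso i : (i <= b)%N -> iso_on (far i) (M i) (P (b - i)).
Proof.
elim: i => [|i ih] hi.
  rewrite subn0; have [eo [f [f' [h c]]]] := @del_rep_iso k n (P b) cut.
  have sub v : far 0 v -> ~~ cut v by move=> fv; apply/negP => /fv; rewrite dist_self.
  split=> //; exists f, f'; split=> [v /sub/h //|a a' aa /sub ha /sub ha']; exact: c.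
have := ih (ltnW hi); rewrite (_ : (b - i = (b - i.+1).+1)%N); last by lia.
move=> ih'; apply: (iso_on_sigma ih' (sigma_spec (M i)) (infl_is_sigma k hn hP (b - i.+1))).
move=> v fv; split=> [z hz|sv l z hz]; first by have := fv z hz; lia.
have := fv z hz; have := dist_adj z (adj_nb v l).
(* Deleted vertices are sinks of M_0, so they are not neighbours of another sink v; hence the first
   shift does not spread the change. *)
have hne : dist z (nb v l) <> 0%N \/ (0 < i)%N.
  case: (posnP i) => [i0|]; last by right.
  left=> /eqP; rewrite dist_eq0 => /eqP e.
  have := flow_sinkE i v; rewrite sv => /esym/eqP hp.
  have := dist_adj x (adj_nb v l); have /andP[/eqP er _] := hz; rewrite e er => hd.
  by lia.
lia.
Qed.

Lemma flow_dm_far i v : (i <= b)%N -> far i v -> dm (M i) v = dm (P (b - i)) v.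
Proof. by move=> hi; apply: iso_on_dm (flow_iso hi). Qed.

(** On [far i] the support is that of [P (b - i)], the ball of radius r - i around x; the remaining
    vertices are close to a deleted one. *)
Lemma flow_supp i v : (i <= b)%N -> (0 < dm (M i) v)%N ->
  (dist x v + i <= r)%N \/ exists2 z, cut z & (dist z v < maxn i 1)%N.
Proof.
move=> hi nz; have [fv|nf] := classic (far i v).
  by left; move: nz; rewrite flow_dm_far // => /infl_dm_le; rewrite /rho; lia.
right; apply: NNPP => h; apply: nf => z hz; rewrite leqNgt; apply/negP => hd.
by apply: h; exists z.
Qed.

Lemma flow_dm0_le v : (0 < dm (M 0) v)%N -> (dist x v <= r)%N.
Proof.
move=> /flow_supp [] //; first by lia.
by move=> [z /andP[/eqP <- _]] h; have := dist_triangle x z v; lia.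
Qed.

Lemma flow_dm_in i v : (i <= b)%N -> (0 < i)%N -> (dist x v + i <= r)%N -> (0 < dm (M i) v)%N.
Proof.
move=> hi i0 hv; rewrite flow_dm_far //; last exact: far_in.
by apply: infl_dm => //; rewrite /rho; lia.
Qed.

Lemma flow_dm0_in v : ~~ cut v -> (dist x v <= r)%N -> (0 < dm (M 0) v)%N.
Proof.
move=> cv hv; rewrite /M /= /del_dm (negPf cv).
by apply: infl_dm => //; rewrite rho_b.
Qed.

(** * Surjective maps along a geodesic from x through y *)

Section Ray.
Variable G : nat -> Vtx n.
Hypothesis Gadj : forall t, adj (G t) (G t.+1).
Hypothesis Gne : forall t, G t != G t.+2.
Hypothesis G0 : G 0%N = x.
Hypothesis Gb : G b = y.

Lemma ray_dist_x t : dist x (G t) = t.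
Proof. by have := ray_dist Gadj Gne t; rewrite G0. Qed.

Lemma ray_dist_y t : dist y (G (b + t)%N) = t.
Proof.
have := @ray_dist n (fun j => G (b + j)%N) _ _ t; rewrite addn0 Gb; apply => j.
  by rewrite addnS.
by rewrite !addnS.
Qed.

Lemma ray_cut : cut (G r).
Proof. by rewrite /cut ray_dist_x eqxx /= -{1}rho_b addnC ray_dist_y. Qed.

Definition full_at i t :=
  row_full (mp (M i) (G t.+1) (G t)) /\
  ((0 < t)%N -> row_full (mp (M i) (G t.-1) (G t))).

Lemma ray_adj_pred t : (0 < t)%N -> adj (G t.-1) (G t).
Proof. by case: t => // t _; apply: Gadj. Qed.

Lemma ray_full_up i t : is_sink (ori (M i)) (G t.+1) ->
  row_full (mp (M i) (G t.+2) (G t.+1)) -> row_full (mp (M i.+1) (G t.+1) (G t)).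
Proof.
by move=> st; apply: sigma_row_full => //; rewrite adj_sym.
Qed.

Lemma ray_full_down i t : is_sink (ori (M i)) (G t) -> (0 < t)%N ->
  row_full (mp (M i) (G t.-1) (G t)) -> row_full (mp (M i.+1) (G t) (G t.+1)).
Proof.
case: t => // t st _; apply: sigma_row_full => //; first by rewrite adj_sym.
by rewrite eq_sym.
Qed.

(** Before the first shift the sinks at positions t >= r are all zero, thanks to the deletion at
    position r, so the claim is vacuous there. Each shift moves surjectivity one step along the ray
    in both directions, which extends the range inwards by one. *)
Lemma ray_full i : (i <= b)%N -> forall t, (r <= t + i)%N ->
  is_sink (ori (M i)) (G t) -> full_at i t.
Proof.
elim: i => [|i ih] hi t ht st.
  have e : dm (M 0) (G t) = 0%N.
    rewrite /M /= /del_dm; case: ifP => // ct; apply/eqP; rewrite -leqn0 leqNgt.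
    apply/negP => /infl_dm_le; rewrite rho_b ray_dist_x => h.
    have et : t = r by lia.
    by rewrite et ray_cut in ct.
  by split=> [|_]; apply: row_full_dim0.
have st' : ~~ is_sink (ori (M i)) (G t) by move: st; rewrite /M /= is_sinkN.
have su : is_sink (ori (M i)) (G t.+1) by rewrite (is_sink_adj _ (Gadj t)).
have ih' := ih (ltnW hi); split.
  by apply: ray_full_up => //; have [|//|] := ih' t.+1; first by lia.
have := flow_sinkE i.+1 (G t); rewrite st ray_dist_x => /esym/eqP hp.
case: t ht st hp st' su => // t ht st hp st' su _.
have [h|h] := leqP r (t + i).
  have sd : is_sink (ori (M i)) (G t).
    by rewrite -[is_sink _ _]negbK -(is_sink_adj _ (Gadj t)).
  have [|//|_ F] := ih' t; first by lia.
  have t0 : (0 < t)%N by move: hi h hbr; rewrite -/b; clear; lia.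
  exact: ray_full_down (F t0).
(* By parity only the new innermost position r - (i + 1) remains. It is a leaf of the ball
   [P (b - i.-1)] with predecessor understood as b - (i + 1), where [infl_leaf_full] provides the
   outward surjection. *)
have ar : arrow (ori (M i.+1)) (G t) (G t.+1) by rewrite /arrow Gadj.
apply: (iso_on_row_full (flow_iso hi) ar).
- by apply: far_in => //; rewrite ray_dist_x; lia.
- by apply: far_in => //; rewrite ray_dist_x; lia.
apply: (infl_leaf_full hn hP); rewrite ?ray_dist_x //; last by rewrite /rho; lia.
by have [<- _] := flow_iso hi.
Qed.

(** After b shifts the range of [ray_full] starts at rho, and inside that radius M_b agrees with the
    thin ball, whose maps are identities. *)
Lemma ray_full_b t : is_sink (ori (M b)) (G t) -> full_at b t.
Proof.
move=> st; have [h|h] := leqP r (t + b); first exact: ray_full.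
have hf u : (u <= rho)%N -> far b (G u) by move=> hu; apply: far_in => //; rewrite ray_dist_x /rho; lia.
have F u v : (u < rho.+1)%N -> (v < rho.+1)%N -> arrow (ori (M b)) (G u) (G v) ->
    row_full (mp (M b) (G u) (G v)).
  move=> hu hv ar; have := flow_iso (leqnn b); rewrite subnn => iso.
  apply: (iso_on_row_full iso ar); [exact: hf|exact: hf|].
  by apply: (ball_mp_in 1 0 _ _ _).2; rewrite ray_dist_x.
have tr : (t < rho)%N by rewrite /rho; lia.
split=> [|t0]; apply: F; rewrite /arrow ?st ?andbT ?ray_adj_pred //; try lia.
by rewrite adj_sym Gadj.
Qed.

Lemma ray_nz_step i t : is_sink (ori (M i)) (G t) -> full_at i t -> (0 < t)%N ->
  (0 < dm (M i) (G t.-1))%N -> (0 < dm (M i.+1) (G t))%N.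
Proof.
case: t => // t st [F _] _ nz.
apply: (row_full_pos (A := mp (M i.+1) (G t.+1) (G t))); first exact: ray_full_up.
rewrite /M iterS [dm _ _]sigma_dm_source //.
by rewrite -(is_sink_adj _ (Gadj t)).
Qed.

(** The deleted vertex at position r reappears with the first shift, because it then maps onto its
    nonzero predecessor's side by surjectivity; from there the support advances one step per
    shift. *)
Lemma ray_nz i : (i <= b)%N -> forall t, (t < r + i)%N -> (0 < dm (M i) (G t))%N.
Proof.
elim: i => [|i ih] hi t ht.
  by apply: flow_dm0_in; rewrite ?ray_dist_x /cut ?ray_dist_x; [apply/nandP; left|]; lia.
have [h|h] := leqP (t + i.+1) r; first by apply: flow_dm_in; rewrite ?ray_dist_x.
have := flow_sinkE i (G t); rewrite ray_dist_x.
have [st /esym/eqP hp|st /esym/eqP hp] := boolP (is_sink (ori (M i)) (G t)).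
  apply: ray_nz_step => //; last by apply: ih; lia.
    by apply: ray_full => //; lia.
  lia.
rewrite /M iterS [dm _ _]sigma_dm_source //; apply: ih; lia.
Qed.

Lemma ray_nz_b t : (0 < t)%N -> (t < r + b.+1)%N -> (0 < dm (M b.+1) (G t))%N.
Proof.
move=> t0 ht; have := flow_sinkE b (G t); rewrite ray_dist_x.
have [st /esym/eqP hp|st /esym/eqP hp] := boolP (is_sink (ori (M b)) (G t)).
  by apply: ray_nz_step => //; [exact: ray_full_b|apply: ray_nz => //; lia].
rewrite /M iterS [dm _ _]sigma_dm_source //; apply: ray_nz; lia.
Qed.

End Ray.

Lemma path_last : nth x (x :: s) b = y.
Proof. by rewrite /y (last_nth x). Qed.

Let a' := nth x (x :: s) b.-1.

Lemma adj_path_last : adj a' y.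
Proof.
have e : b.-1.+1 = b by apply: prednK.
have /andP[/(pathP x)/(_ b.-1) p _] := hpath.
by have := p _; rewrite -[nth x s _]/(nth x (x :: s) b.-1.+1) e path_last; apply.
Qed.

Definition ext_ray (i j : 'I_n) (t : nat) : Vtx n :=
  if (t < b)%N then nth x (x :: s) t else ray y i j (t - b).

Lemma ext_ray_le i j t : (t <= b)%N -> ext_ray i j t = nth x (x :: s) t.
Proof.
rewrite leq_eqVlt /ext_ray => /orP[/eqP ->|->] //.
by rewrite ltnn subnn /= path_last.
Qed.

Lemma ext_ray_ge i j m : ext_ray i j (b + m)%N = ray y i j m.
Proof. by rewrite /ext_ray ltnNge leq_addr /= addKn. Qed.

Section Extend.
Variables i j : 'I_n.
Hypothesis ij : i != j.
Hypothesis ia : nb y i != a'.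

Lemma ext_ray_adj t : adj (ext_ray i j t) (ext_ray i j t.+1).
Proof.
have [h|h] := ltnP t b.
  rewrite !ext_ray_le ?(ltnW h) //.
  by have /andP[/(pathP x) p _] := hpath; apply: p.
by rewrite -(subnKC h) -addnS !ext_ray_ge; apply: ray_adj.
Qed.

Lemma ext_ray_ne t : ext_ray i j t != ext_ray i j t.+2.
Proof.
have [h|h] := leqP b t.
  by rewrite -(subnKC h) -!addnS !ext_ray_ge; apply: ray_ne.
have [h'|h'] := leqP t.+2 b.
  rewrite !ext_ray_le ?(ltnW h) //.
  by have /andP[_ /allP p] := hpath; apply: p; rewrite mem_iota -/b; lia.
have et : t.+1 = b by lia.
rewrite ext_ray_le ?(ltnW h) // (_ : t.+2 = (b + 1)%N) ?ext_ray_ge; last by lia.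
by rewrite eq_sym (_ : t = b.-1) //; lia.
Qed.

Lemma ext_ray0 : ext_ray i j 0 = x.
Proof. by rewrite ext_ray_le. Qed.

Lemma ext_rayb : ext_ray i j b = y.
Proof. by rewrite ext_ray_le // path_last. Qed.

Lemma ext_full m : is_sink (ori (M b)) (ray y i j m) ->
  row_full (mp (M b) (ray y i j m.+1) (ray y i j m)) /\
  ((0 < m)%N -> row_full (mp (M b) (ray y i j m.-1) (ray y i j m))).
Proof.
have := ray_full_b ext_ray_adj ext_ray_ne ext_ray0 ext_rayb (t := (b + m)%N).
rewrite /full_at -addnS !ext_ray_ge => H /H[h1 h2]; split=> // m0.
have := h2 _; rewrite (_ : (b + m).-1 = (b + m.-1)%N); last by lia.
by rewrite ext_ray_ge; apply; lia.
Qed.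

Lemma ext_nz m : (m <= r)%N -> (0 < dm (M b.+1) (ray y i j m))%N.
Proof.
move=> hm; rewrite -ext_ray_ge.
apply: (ray_nz_b ext_ray_adj ext_ray_ne ext_ray0 ext_rayb); first by rewrite addn_gt0 hb.
lia.
Qed.

Lemma dist_path l : (l <= b)%N ->
  dist (nth x (x :: s) l) x = l /\ dist (nth x (x :: s) l) y = (b - l)%N.
Proof.
move=> hl; rewrite -(ext_ray_le i j hl); split.
  by rewrite dist_sym; apply: (ray_dist_x ext_ray_adj ext_ray_ne ext_ray0).
have := @ray_dist n (fun t => ext_ray i j (l + t)%N) _ _ (b - l)%N.
rewrite addn0 subnKC // ext_rayb; apply=> t; rewrite !addnS; [exact: ext_ray_adj|exact: ext_ray_ne].
Qed.

(** The path comes from distance r - i0 on a side of x avoiding a_1, runs through the center path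
    and ends at distance r + i0 - 1 from x; the lengths add up to 2r - 1. *)
Lemma flow_path i0 (i' j' : 'I_n) : (0 < i0 <= b)%N -> i' != j' -> nb x i' != nth x (x :: s) 1 ->
  exists p q, supp_path (M i0) p q /\ size q = r.*2.-1.
Proof.
move=> /andP[i1 ib] ij' ia'.
pose q t := if (t < r - i0)%N then ray x i' j' (r - i0 - t) else ext_ray i j (t - (r - i0)).
have qge t : q (r - i0 + t)%N = ext_ray i j t.
  by rewrite /q ltnNge leq_addr /= addKn.
have qle t : (t <= r - i0)%N -> q t = ray x i' j' (r - i0 - t).
  rewrite /q leq_eqVlt => /orP[/eqP ->|->] //.
  by rewrite ltnn subnn ext_ray0.
have e1 : ext_ray i j 1 = nth x (x :: s) 1 by rewrite ext_ray_le.
apply: (@supp_path_fun k n (M i0) q).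
- move=> t _; have [h|h] := ltnP t (r - i0).
    rewrite !qle ?(ltnW h) // adj_sym (_ : (r - i0 - t = (r - i0 - t.+1).+1)%N) ?ray_adj //; lia.
  by rewrite -(subnKC h) -addnS !qge; apply: ext_ray_adj.
- move=> t _; have [h|h] := leqP (r - i0) t.
    by rewrite -(subnKC h) -!addnS !qge; apply: ext_ray_ne.
  have [h'|h'] := leqP t.+2 (r - i0).
    rewrite !qle ?(ltnW h) // eq_sym (_ : (r - i0 - t = (r - i0 - t.+2).+2)%N); last by lia.
    exact: ray_ne.
  rewrite qle ?(ltnW h) // (_ : t.+2 = (r - i0 + 1)%N); last by lia.
  by rewrite qge e1 (_ : (r - i0 - t = 1)%N) //; lia.
move=> t ht; have [h|h] := leqP t (r - i0).
  by rewrite qle //; apply: flow_dm_in => //; rewrite dist_ray //; lia.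
rewrite -(subnKC (ltnW h)) qge.
apply: (ray_nz ext_ray_adj ext_ray_ne ext_ray0 ext_rayb ib); lia.
Qed.
End Extend.

Lemma avoid_letters v w : adj v w -> exists i j : 'I_n, [/\ i != j, nb v i != w & nb v j != w].
Proof.
move=> /adjP[l ->]; have [j1 [j2 [n1 n2 p]]] := other_letters hn l.
exists j1, j2; split; last 2 first.
- by apply: contraNneq n1 => /(@nb_inj n) ->.
- by apply: contraNneq n2 => /(@nb_inj n) ->.
by apply/eqP => e; move: p; rewrite e => -[[]|[]|[]]; lia.
Qed.

(** The deleted vertices lie on the sphere of radius r, outside the support of the indecomposable
    shift [P (b - 1)] of [P b]. *)
Lemma flow_indecomposable : indecomposable flow_rep.
Proof.
have eb : b = b.-1.+1 by rewrite prednK.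
rewrite /flow_rep eb; apply: (del_rep_indecomposable (infl_is_sigma k hn hP b.-1)).
- move=> v cv; rewrite -eb; split; first exact: cut_sink.
  apply/eqP; rewrite -leqn0 leqNgt; apply/negP => /infl_dm_le.
  by have /andP[/eqP -> _] := cv; have := rho_b; lia.
- by move=> v; apply: infl_sink_surj.
exact: (infl_indecomposable k hn hP).
Qed.

(** For v in the ball around x the distances to a_(l-1) and a_l are at most r - 1 and r; for v near
    a deleted vertex the bounds are r and r - 1. *)
Lemma flow_supp_edge l v : (0 < l <= b)%N -> (0 < dm (M l) v)%N ->
  (dist (nth x (x :: s) l.-1) v + dist (nth x (x :: s) l) v <= r.*2.-1)%N.
Proof.
move=> /andP[l1 lb].
have [i [j [ij n1 _]]] : exists i j : 'I_n, [/\ i != j, nb y i != a' & nb y j != a'].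
  by apply: avoid_letters; rewrite adj_sym adj_path_last.
have [x1 y1] := dist_path ij n1 lb.
have [x2 y2] := dist_path ij n1 (leq_trans (leq_pred l) lb).
move=> /(flow_supp lb); rewrite (maxn_idPl l1) => -[h|[z /andP[_ /eqP cz] hz]].
  have := dist_triangle (nth x (x :: s) l) x v.
  have := dist_triangle (nth x (x :: s) l.-1) x v.
  rewrite x1 x2; move: h l1; clear; lia.
have := dist_triangle (nth x (x :: s) l) y z.
have := dist_triangle (nth x (x :: s) l.-1) y z.
have := dist_triangle (nth x (x :: s) l) z v.
have := dist_triangle (nth x (x :: s) l.-1) z v.
rewrite y1 y2 cz; move: rho_b lb l1 hz; move: rho (b); clear; lia.
Qed.

(** Around deleted vertices the radius may grow from b - 1 to b, which gives distance at most rho +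
    b = r from y. The ball around x keeps radius rho, since the sinks of M_b have the parity of
    rho. *)
Lemma flow_last_supp v : (0 < dm (M b.+1) v)%N -> (dist y v <= r)%N.
Proof.
have [i [j [ij n1 n2]]] : exists i j : 'I_n, [/\ i != j, nb y i != a' & nb y j != a'].
  by apply: avoid_letters; rewrite adj_sym adj_path_last.
have [_ xy] := dist_path ij n1 (leq0n b); rewrite /= subn0 in xy.
have yz z : cut z -> dist y z = rho by move=> /andP[_ /eqP].
have hrb := rho_b.
have U u : (0 < dm (M b) u)%N -> (dist x u <= rho)%N \/ exists2 z, cut z & (dist z u < b)%N.
  move=> /flow_supp[]//; first by left; rewrite /rho; lia.
  by rewrite (maxn_idPl hb); right.
have := flow_sinkE b v.
have [sv /esym/eqP hp|sv /esym/eqP hp] := boolP (is_sink (ori (M b)) v); last first.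
  rewrite /M iterS [dm _ _]sigma_dm_source // => /U[h|[z cz h]].
    by have := dist_triangle y x v; rewrite (dist_sym y x) xy; move: h hrb; clear; lia.
  by have := dist_triangle y z v; rewrite (yz z cz); move: h hrb; clear; lia.
rewrite /M iterS => /(sigma_supp sv)[l /U[h|[z cz h]]].
  have := dist_adj x (adj_nb v l); have := dist_triangle y x v; rewrite (dist_sym y x) xy; move: h hrb hp; clear; lia.
by have := dist_triangle y z v; rewrite (yz z cz); have := dist_adj z (adj_nb v l); move: h hrb; clear; lia.
Qed.

Lemma flow_case : fin_supp flow_rep /\ indecomposable flow_rep /\ regular flow_rep /\
  is_M0 flow_rep /\ radius flow_rep r /\ center_path flow_rep x s.
Proof.
split; first by exists (ball_seq x r) => v nz; apply/mem_ball/flow_dm0_le.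
split; first exact: flow_indecomposable.
have /andP[/(pathP x) pa _] := hpath.
pose a1 := nth x (x :: s) 1.
have xa : adj x a1 by apply: (pa 0%N).
have ya : adj y a' by rewrite adj_sym adj_path_last.
have [i [j [ij n1 n2]]] := avoid_letters xa.
have [i' [j' [ij' n1' n2']]] := avoid_letters ya.
have ji : j != i by rewrite eq_sym.
have ji' : j' != i' by rewrite eq_sym.
have hrb := rho_b.
have dp := dist_path ij' n1'.
(* the line through x avoiding a_1, along which all maps of M_0 are injective *)
have hL := is_line_of x ij; set L := line_of x i j in hL.
have dL t : dist x (L t) = `|t|%N by have := line_dist0 t hL.
have a1ray (c d : 'I_n) m : c != d -> nb x c != a1 -> dist a1 (ray x c d m) = m.+1.
  move=> cd nc; have := @ray_dist n (fun l => if l is l'.+1 then ray x c d l' else a1) _ _ m.+1.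
  apply; first by case=> [|l]; [rewrite adj_sym|apply: ray_adj].
  by case=> [|l]; [rewrite eq_sym|apply: ray_ne].
have dL1 t : dist a1 (L t) = `|t|.+1.
  by case: t => m; rewrite /L /line_of a1ray.
(* A deleted vertex on L would be at distance r + 1 from a_1, but the way from a_1 through y has
   only length (b - 1) + rho = r - 1. *)
have Lcut t : ~~ cut (L t).
  apply/negP => /andP[/eqP c1 /eqP c2].
  have := dist_triangle a1 y (L t); rewrite dL in c1; rewrite c2 dL1 c1.
  have [_ ->] := dp 1%N hb => h.
  suff /(leq_trans h) : (b - 1 + rho <= r)%N by rewrite ltnn.
  by rewrite -hrb addnC leq_add2l leq_subr.
have nzL t : (`|t| <= r)%N -> (0 < dm flow_rep (L t))%N.
  by move=> h; apply: flow_dm0_in; rewrite ?dL.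
have parL t : `|t|%N = r.+1 -> ~~ is_sink (ori flow_rep) (L t).
  by move=> e; have := flow_sinkE 0 (L t); rewrite dL e addn0 /= => ->; case: (odd r).
have E : lineE (sigmam flow_rep) L.
  apply: lineE_sigmam => // p q pq sp.
  have ar : arrow (ori flow_rep) (L p) (L q).
    by rewrite /arrow (line_adj hL pq) (line_sink _ hL pq).
  apply: (iso_on_row_free (@del_rep_iso k n (P b) cut) ar (Lcut p) (Lcut q)).
  exact: (@infl_row_free k n hn _ x rho hP b _ _ ar).
(* the line through a_b avoiding a_(b-1), along which all maps of M_b are surjective *)
have hL' := is_line_of y ij'; set L' := line_of y i' j' in hL'.
have F1 := ext_full ij' n1'; have F2 := ext_full ji' n2'.
have D : lineD (M b) L'.
  move=> p q [->|->]; rewrite /L'.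
    case: q => [m|[|m]] sq; first by rewrite -PoszD addn1; apply: (F1 m sq).1.
      exact: ((F2 1%N sq).2 isT).
    rewrite Negz_add1.
    exact: ((F2 m.+2 sq).2 isT).
  case: p => [m|[|m]].
  - by rewrite -PoszD addn1 => sq; apply: ((F1 m.+1 sq).2 isT).
  - by move=> sq; apply: (F2 0%N sq).1.
  rewrite Negz_add1.
  by move=> sq; apply: (F2 m.+1 sq).1.
have D' : lineD (sigma (M b.+1)) L' by do 2!apply: lineD_sigma => //.
have nzL' t : (`|t| <= r)%N -> (0 < dm (M b.+1) (L' t))%N.
  case: t => m hm; [exact: (ext_nz ij' n1' hm)|exact: (ext_nz ji' n2' hm)].
have dL' t : dist x (L' t) = (b + `|t|)%N.
  case: t => m; rewrite /L' /line_of.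
    have := ray_dist_x (ext_ray_adj i' j') (ext_ray_ne ij' n1') (ext_ray0 i' j') (b + m).
    by rewrite ext_ray_ge => ->.
  have := ray_dist_x (ext_ray_adj j' i') (ext_ray_ne ji' n2') (ext_ray0 j' i') (b + m.+1).
  by rewrite ext_ray_ge => ->.
have parL' t : `|t|%N = r.+1 -> is_sink (ori (M b.+1)) (L' t).
  by move=> e; rewrite flow_sinkE dL' e !addnS addnC.
have ori0 : ori flow_rep = Omega by have := flow_ori 0; rewrite /M /= addbF.
apply: (@shift_orbit_criterion k n flow_rep x s r) => //.
- by rewrite ori0.
- exact: (ball_grow_sigmam flow_dm0_le).
- by move=> l; apply: (supp_path_line hL); apply: (line_grow_sigmam hL hr E).
- by move=> l v; apply: flow_supp_edge.
- by move=> l lb; apply: (flow_path ij' n1' _ ij n1); rewrite lb.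
- by move=> l v; rewrite addnC iterD; apply: ball_grow_sigma flow_last_supp l v.
move=> l; apply: (supp_path_line hL') => t ht; rewrite addnC iterD.
exact: (line_grow_sigma hL' hr D' parL' nzL').
Qed.

End CaseFlow.

Local Close Scope ring_scope.

Theorem theorem2 (k : fieldType) (n : nat) (hn : (3 <= n)%N) (Omega : bool)
  (r : nat) (hr : (0 < r)%N) (b : nat) (a0 : Vtx n) (s : seq (Vtx n))
  (hpath : is_tpath a0 s) (hb : size s = b) (hbr : (b <= r)%N)
  (hsink : is_sink Omega a0 = ~~ odd r) :
  exists M : rep k n,
    ori M = Omega /\ fin_supp M /\ indecomposable M /\ regular M /\
    is_M0 M /\ radius M r /\ center_path M a0 s.
Proof.
subst b; have [/size0nil s0|s_gt0] := posnP (size s).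
  by exists (star_rep k Omega a0 r); split=> //; rewrite s0; apply: star_case.
exists (flow_rep k Omega a0 s r); split; last exact: flow_case.
by have := flow_ori k Omega a0 s r 0; rewrite /= addbF.
Qed.
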